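(* Let $n\ge1$. The space $\Sigma_{\mathrm{inv}}$ of $\mathrm{Sp}(n+1)$-invariant (classical) spinors on $\mathbb{CP}^{2n+1}=\mathrm{Sp}(n+1)/(\mathrm U(1)\times\mathrm{Sp}(n))$, for its unique spin structure, is $$\Sigma_{\mathrm{inv}}=\begin{cases}\mathrm{span}_{\mathbb C}\{\psi_+=\omega^{(n+1)/2},\ \psi_-=y_1\wedge\omega^{(n-1)/2}\},&n\text{ odd},\\0,&n\text{ even},\end{cases}$$ where $\omega=\sum_{p=1}^ny_{2p}\wedge y_{2p+1}$.
   Context: Matrices: $E^{(N)}_{i,j}$ has $-1$ at $(i,j)$, $+1$ at $(j,i)$; $F^{(N)}_{i,j}$ ($i\neq j$) has $1$ at $(i,j)$, $(j,i)$; $F^{(N)}_{i,i}$ has a single $1$ at $(i,i)$; $B_0(X,Y)=-\mathrm{Re}\,\mathrm{tr}(XY)$; ${\rm i},{\rm j},{\rm k}$ quaternion units. Setting: $H=\mathrm U(1)\times\mathrm{Sp}(n)$ block-diagonal in $\mathrm{Sp}(n+1)$. Reductive complement $\mathfrak m=\mathcal V\oplus\mathcal H$, $\mathcal V=\mathrm{span}_{\mathbb R}\{\xi_2=-{\rm k}F^{(n+1)}_{1,1},\xi_3={\rm j}F^{(n+1)}_{1,1}\}$, $\mathcal H=\mathrm{span}_{\mathbb R}\{e_{4p}={\rm j}F^{(n+1)}_{1,p+1},e_{4p+1}={\rm k}F^{(n+1)}_{1,p+1},e_{4p+2}={\rm i}F^{(n+1)}_{1,p+1},e_{4p+3}=E^{(n+1)}_{1,p+1}\}_{p=1}^n$.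 Invariant metrics $g_{a,t}=aB_0|_{\mathcal H\times\mathcal H}+2at\,B_0|_{\mathcal V\times\mathcal V}$, $a,t>0$, with orthonormal basis $\xi_l^{a,t}=\xi_l/\sqrt{2ta}$, $e_q^{a,t}=e_q/\sqrt{2a}$; orientation $(\xi_2^{a,t},\xi_3^{a,t},e_4^{a,t},\dots,e_{4n+3}^{a,t})$. $\sigma:H\to\mathrm{SO}(4n+2)$ is the isotropy representation, which lifts to $\widetilde\sigma:H\to\mathrm{Spin}(4n+2)$, giving the unique spin structure. Spin representation: put $y_1=\frac1{\sqrt2}(\xi_2^{a,t}+{\rm i}\xi_3^{a,t})$, $y_{2p}=\frac1{\sqrt2}(e_{4p}^{a,t}+{\rm i}e_{4p+1}^{a,t})$, $y_{2p+1}=\frac1{\sqrt2}(e_{4p+2}^{a,t}+{\rm i}e_{4p+3}^{a,t})$ (complex ${\rm i}$) and $x_q=\overline{y_q}$. Then $\Sigma_{4n+2}=\Lambda^\bullet\mathrm{span}_{\mathbb C}\{y_1,\dots,y_{2n+1}\}$ with Clifford action $x_q\cdot\eta={\rm i}\sqrt2\,x_q\lrcorner\eta$, $y_q\cdot\eta={\rm i}\sqrt2\,y_q\wedge\eta$ ($x_q\lrcorner y_l=\delta_{ql}$, $v\cdot v=-|v|^2$). Invariant spinors are identified with elements of $\Sigma_{4n+2}$ fixed by $\widetilde\sigma(H)$; powers of $\omega$ are exterior powers. *)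

(* Defs.v *)
From HB Require Import structures.
From mathcomp Require Import all_boot all_order all_algebra.
From mathcomp Require Import complex ring.

Set Implicit Arguments.
Unset Strict Implicit.
Unset Printing Implicit Defensive.

Import Order.TTheory GRing.Theory Num.Theory.

Local Open Scope ring_scope.

Record quat (R : Type) := Quat { qre : R; qi : R; qj : R; qk : R }.

Definition quat_tuple (R : Type) (x : quat R) : R * R * R * R :=
  (qre x, qi x, qj x, qk x).
Definition tuple_quat (R : Type) (x : R * R * R * R) : quat R :=
  Quat x.1.1.1 x.1.1.2 x.1.2 x.2.

Lemma quat_tupleK (R : Type) : cancel (@quat_tuple R) (@tuple_quat R).
Proof. by case. Qed.

HB.instance Definition _ (R : eqType) :=
  Equality.copy (quat R) (can_type (@quat_tupleK R)).
HB.instance Definition _ (R : choiceType) :=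
  Choice.copy (quat R) (can_type (@quat_tupleK R)).

Section QuatRing.
Variable R : comNzRingType.
Implicit Types x y z : quat R.

Definition addq x y :=
  Quat (qre x + qre y) (qi x + qi y) (qj x + qj y) (qk x + qk y).
Definition oppq x := Quat (- qre x) (- qi x) (- qj x) (- qk x).
Definition mulq x y := Quat
  (qre x * qre y - qi x * qi y - qj x * qj y - qk x * qk y)
  (qre x * qi y + qi x * qre y + qj x * qk y - qk x * qj y)
  (qre x * qj y - qi x * qk y + qj x * qre y + qk x * qi y)
  (qre x * qk y + qi x * qj y - qj x * qi y + qk x * qre y).

Let addqA : associative addq.
Proof. by move=> x y z; rewrite /addq /= !addrA. Qed.
Let addqC : commutative addq.
Proof.
move=> x y; rewrite /addq [qre x + _]addrC [qi x + _]addrC.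
by rewrite [qj x + _]addrC [qk x + _]addrC.
Qed.
Let add0q : left_id (Quat 0 0 0 0) addq.
Proof. by case=> a b c d; rewrite /addq /= !add0r. Qed.
Let addNq : left_inverse (Quat 0 0 0 0) oppq addq.
Proof. by move=> x; rewrite /addq /= !addNr. Qed.

HB.instance Definition _ :=
  GRing.isZmodule.Build (quat R) addqA addqC add0q addNq.

Let mulqA : associative mulq.
Proof. by case=> ? ? ? ? [? ? ? ?] [? ? ? ?]; congr Quat; rewrite /=; ring. Qed.
Let mul1q : left_id (Quat 1 0 0 0) mulq.
Proof. by case=> ? ? ? ?; congr Quat; rewrite /=; ring. Qed.
Let mulq1 : right_id (Quat 1 0 0 0) mulq.
Proof. by case=> ? ? ? ?; congr Quat; rewrite /=; ring. Qed.
Let mulqDl : left_distributive mulq +%R.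
Proof. by case=> ? ? ? ? [? ? ? ?] [? ? ? ?]; congr Quat; rewrite /=; ring. Qed.
Let mulqDr : right_distributive mulq +%R.
Proof. by case=> ? ? ? ? [? ? ? ?] [? ? ? ?]; congr Quat; rewrite /=; ring. Qed.
Let oneq_neq0 : Quat 1 0 0 0 != 0 :> quat R.
Proof. by apply/eqP => -[/eqP]; rewrite oner_eq0. Qed.

HB.instance Definition _ := GRing.Zmodule_isNzRing.Build (quat R)
  mulqA mul1q mulq1 mulqDl mulqDr oneq_neq0.

Definition conjq x := Quat (qre x) (- qi x) (- qj x) (- qk x).
Definition realq (r : R) := Quat r 0 0 0.
Definition iq : quat R := Quat 0 1 0 0.
Definition jq : quat R := Quat 0 0 1 0.
Definition kq : quat R := Quat 0 0 0 1.

Definition adjq (m n : nat) (A : 'M[quat R]_(m, n)) : 'M[quat R]_(n, m) :=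
  (map_mx conjq A)^T.

End QuatRing.

Arguments iq {R}.
Arguments jq {R}.
Arguments kq {R}.

Definition Sp (R : comNzRingType) (n : nat) (A : 'M[quat R]_n) : Prop :=
  A *m adjq A = 1%:M /\ adjq A *m A = 1%:M.

(* The circle of a + b i with a^2 + b^2 = 1, inside the unit quaternions. *)
Definition U1 (R : comNzRingType) (z : quat R) : Prop :=
  [/\ qj z = 0, qk z = 0 & qre z ^+ 2 + qi z ^+ 2 = 1].

Definition U1Sp (R : comNzRingType) (n : nat) (h : 'M[quat R]_(1 + n)) : Prop :=
  exists z A, [/\ U1 z, Sp A & h = block_mx z%:M 0 0 A].

(* The Clifford algebra of the form q (x_1^2 + ... + x_m^2) over K:    *)
(* x A is the coefficient of e_A = e_{i_1} ... e_{i_k}, where          *)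
(* A = {i_1 < ... < i_k}, and e_i e_i = q, e_i e_j = - e_j e_i.        *)
(* For q = -1 this is the algebra Cl_m with v v = -|v|^2; for q = 0 it *)
(* is the exterior algebra, its product being the wedge product.       *)

Definition cliff (K : comNzRingType) (q : K) (m : nat) : Type :=
  {ffun {set 'I_m} -> K^o}.

Definition symdiff (T : finType) (A B : {set T}) : {set T} :=
  (A :\: B) :|: (B :\: A).

Section Cliff.
Variables (K : comNzRingType) (q : K) (m : nat).
Implicit Types (A B C : {set 'I_m}) (x y z : cliff q m).

HB.instance Definition _ :=
  GRing.Lmodule.copy (cliff q m) {ffun {set 'I_m} -> K^o}.

(* e_A e_B = cliff_coef A B *: e_(symdiff A B) *)
Definition cliff_coef A B : K :=
  \prod_(i in A) \prod_(j in B)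
    (if (i < j)%N then 1 else if i == j then q else -1).

Definition cliff_mul x y : cliff q m :=
  [ffun C : {set 'I_m} => \sum_A \sum_(B | symdiff A B == C)
     cliff_coef A B * x A * y B].

Definition cliff_base A : cliff q m := [ffun B => (B == A)%:R].

Lemma in_symdiff A B i : (i \in symdiff A B) = (i \in A) (+) (i \in B).
Proof. by rewrite !inE; case: (i \in A); case: (i \in B). Qed.

Lemma symdiffA : associative (@symdiff 'I_m).
Proof. by move=> A B C; apply/setP => i; rewrite !in_symdiff addbA. Qed.

Lemma symdiffK A : involutive (symdiff A).
Proof. by move=> B; apply/setP => i; rewrite !in_symdiff addKb. Qed.

Lemma cliff_coef_cocycle A B C :
  cliff_coef A B * cliff_coef (symdiff A B) C =
  cliff_coef A (symdiff B C) * cliff_coef B C.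
Proof.
have E X Y : cliff_coef X Y = \prod_i \prod_j
    (if (i \in X) && (j \in Y) then
       if (i < j)%N then 1 else if i == j then q else -1 else 1).
  rewrite /cliff_coef big_mkcond; apply: eq_bigr => i _.
  by case: (i \in X) => /=; [rewrite big_mkcond | rewrite big1].
rewrite !E -!big_split; apply: eq_bigr => i _ /=.
rewrite -!big_split; apply: eq_bigr => j _ /=; rewrite !in_symdiff.
case: (altP (i =P j)) => [->|nij].
  rewrite ltnn; case: (j \in A); case: (j \in B); case: (j \in C) => /=; ring.
by case: ltnP => _; case: (i \in A); case: (i \in B); case: (j \in B);
  case: (j \in C) => /=; ring.
Qed.

Lemma cliff_mulE x y C : cliff_mul x y C =
  \sum_A cliff_coef A (symdiff A C) * x A * y (symdiff A C).
Proof.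
rewrite ffunE; apply: eq_bigr => A _; rewrite (big_pred1 (symdiff A C)) // => B.
exact: (can2_eq (symdiffK A) (symdiffK A)).
Qed.

Let cliff_mulA : associative cliff_mul.
Proof.
move=> x y z; apply/ffunP => D; rewrite !cliff_mulE.
under eq_bigr => A _ do rewrite cliff_mulE mulr_sumr.
under [RHS]eq_bigr => A _ do rewrite cliff_mulE mulr_sumr mulr_suml.
rewrite [RHS]exchange_big; apply: eq_bigr => A _ /=.
rewrite [RHS](reindex_inj (can_inj (symdiffK A))); apply: eq_bigr => B _ /=.
rewrite symdiffK.
have -> : symdiff B (symdiff A D) = symdiff (symdiff A B) D.
  by rewrite symdiffA; congr symdiff; apply/setP => i; rewrite !in_symdiff addbC.
set T := symdiff (symdiff A B) D.
have -> : symdiff A D = symdiff B T.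
  by apply/setP => i; rewrite !in_symdiff;
     case: (i \in A); case: (i \in B); case: (i \in D).
transitivity ((cliff_coef A (symdiff B T) * cliff_coef B T) * x A * y B * z T).
  by ring.
by rewrite -cliff_coef_cocycle; ring.
Qed.

Let cliff_mul1x : left_id (cliff_base set0) cliff_mul.
Proof.
move=> x; apply/ffunP => C; rewrite cliff_mulE (bigD1 set0) //= big1 => [|A nA].
  have -> : symdiff set0 C = C by apply/setP => i; rewrite in_symdiff inE.
  by rewrite ffunE eqxx /cliff_coef big_set0 addr0 !mul1r.
by rewrite ffunE (negPf nA) mulr0 mul0r.
Qed.

Let cliff_mulx1 : right_id (cliff_base set0) cliff_mul.
Proof.
move=> x; apply/ffunP => C; rewrite cliff_mulE (bigD1 C) //= big1 => [|A nA].
  have -> : symdiff C C = set0.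
    by apply/setP => i; rewrite in_symdiff inE addbb.
  rewrite ffunE eqxx /cliff_coef big1 => [|i _]; last by rewrite big_set0.
  by rewrite addr0 mul1r mulr1.
rewrite ffunE; case: eqP => [E0|_]; last by rewrite mulr0.
case/eqP: nA; apply/setP => i; have/setP/(_ i) := E0.
by rewrite in_symdiff inE; case: (i \in A); case: (i \in C).
Qed.

Let cliff_mulDl : left_distributive cliff_mul +%R.
Proof.
move=> x y z; apply/ffunP => C; rewrite [RHS]ffunE !cliff_mulE -big_split.
by apply: eq_bigr => A _; rewrite ffunE /= mulrDr mulrDl.
Qed.

Let cliff_mulDr : right_distributive cliff_mul +%R.
Proof.
move=> x y z; apply/ffunP => C; rewrite [RHS]ffunE !cliff_mulE -big_split.
by apply: eq_bigr => A _; rewrite ffunE /= mulrDr.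
Qed.

Let cliff_one_neq0 : cliff_base set0 != 0 :> cliff q m.
Proof.
by apply/eqP => /ffunP/(_ set0)/eqP; rewrite !ffunE eqxx oner_eq0.
Qed.

HB.instance Definition _ := GRing.Zmodule_isNzRing.Build (cliff q m)
  cliff_mulA cliff_mul1x cliff_mulx1 cliff_mulDl cliff_mulDr cliff_one_neq0.

Let cliff_scaleAl (a : K) x y : a *: (x * y) = (a *: x) * y.
Proof.
apply/ffunP => C; rewrite [LHS]ffunE.
rewrite [in LHS]cliff_mulE [RHS]cliff_mulE scaler_sumr.
by apply: eq_bigr => A _; rewrite ffunE /GRing.scale /=; ring.
Qed.

HB.instance Definition _ :=
  GRing.Lmodule_isLalgebra.Build K (cliff q m) cliff_scaleAl.

Let cliff_scaleAr (a : K) x y : a *: (x * y) = x * (a *: y).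
Proof.
apply/ffunP => C; rewrite [LHS]ffunE.
rewrite [in LHS]cliff_mulE [RHS]cliff_mulE scaler_sumr.
by apply: eq_bigr => A _; rewrite ffunE /GRing.scale /=; ring.
Qed.

HB.instance Definition _ :=
  GRing.Lalgebra_isAlgebra.Build K (cliff q m) cliff_scaleAr.

HB.instance Definition _ :=
  Vector.copy (cliff q m) {ffun {set 'I_m} -> K^o}.

Definition cliff_gen (i : 'I_m) : cliff q m := cliff_base [set i].

End Cliff.

From mathcomp Require Import all_classical reals topology normedtype.

Import numFieldNormedType.Exports.

HB.instance Definition _ (R : realType) :=
  Topological.copy (quat R) (initial_topology (@quat_tuple R)).


Local Open Scope classical_set_scope.
Local Open Scope complex_scope.

Section Spin.
Variables (R : realType) (m : nat).
Local Notation Cl := (cliff (-1 : R) m).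

Definition clvec (v : 'cV[R]_m) : Cl := \sum_i v i 0 *: cliff_gen (-1 : R) i.

Definition spin_group (g : Cl) : Prop :=
  exists vs : seq 'cV[R]_m,
    [/\ ~~ odd (size vs),
        forall v, v \in vs -> \sum_i v i 0 ^+ 2 = 1 &
        g = \prod_(v <- vs) clvec v].

(* g v g^-1 = S v for all v in R^m; elements of spin_group are invertible. *)
Definition spin_covers (g : Cl) (S : 'M[R]_m) : Prop :=
  forall v : 'cV[R]_m, g * clvec v = clvec (S *m v) * g.

End Spin.

Section Isotropy.
Variables (R : realType) (n : nat).
Local Notation M := 'M[quat R]_(1 + n).

(* Matrix indices are 0-based: the mathematical pair (1, p+1) is (0, p). *)
Definition mxE (i j : 'I_(1 + n)) : M := delta_mx j i - delta_mx i j.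
Definition mxF (i j : 'I_(1 + n)) : M :=
  if i == j then delta_mx i i else delta_mx i j + delta_mx j i.

Definition xi_ (l : nat) : M :=
  if l == 2 then (- kq) *: mxF ord0 ord0 else jq *: mxF ord0 ord0.

Definition e_ (l : nat) : M :=
  let p : 'I_(1 + n) := inord (l %/ 4) in
  match (l %% 4)%N with
  | 0%N => jq *: mxF ord0 p
  | 1%N => kq *: mxF ord0 p
  | 2%N => iq *: mxF ord0 p
  | _ => mxE ord0 p
  end.

Definition B0 (X Y : M) : R := - qre (\tr (X *m Y)).

(* The projections of m = V + H onto V and H, as maps on all matrices that
   vanish on u(1) + sp(n). *)
Definition vpart (X : M) : M :=
  \matrix_(i, j) if (i == ord0) && (j == ord0)
                 then Quat 0 0 (qj (X i j)) (qk (X i j)) else 0.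
Definition hpart (X : M) : M :=
  \matrix_(i, j) if (i == ord0) (+) (j == ord0) then X i j else 0.

Variables a t : R.

Definition metric (X Y : M) : R :=
  a * B0 (hpart X) (hpart Y) + 2 * a * t * B0 (vpart X) (vpart Y).

(* The oriented orthonormal basis (xi_2, xi_3, e_4, ..., e_{4n+3}), rescaled;
   position i carries the label i + 2. *)
Definition frame (i : 'I_(4 * n).+2) : M :=
  let l := (i + 2)%N in
  if (l < 4)%N then realq (Num.sqrt (2 * t * a))^-1 *: xi_ l
  else realq (Num.sqrt (2 * a))^-1 *: e_ l.

(* The matrix of Ad(h) on m in this basis; h^-1 is adjq h. *)
Definition isotropy (h : M) : 'M[R]_((4 * n).+2) :=
  \matrix_(i, j) metric (frame i) (h *m frame j *m adjq h).

(* A continuous homomorphism from H to Spin(4n+2) over the isotropy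
   representation; s is arbitrary outside H. *)
Definition isotropy_lift (s : M -> cliff (-1 : R) (4 * n).+2) : Prop :=
  [/\ forall h, U1Sp h -> spin_group (s h),
      forall g h, U1Sp g -> U1Sp h -> s (g *m h) = s g * s h,
      forall h, U1Sp h -> spin_covers (s h) (isotropy h) &
      forall A, {within [set h | U1Sp h], continuous (fun h => s h A : R)}].

End Isotropy.

Section Spinors.
Variables (R : realType) (n : nat).
Local Notation C := R[i].

(* The exterior algebra on y_1, ..., y_{2n+1}; y_q is the generator of
   index q - 1. *)
Definition spinor : Type := cliff (0 : C) (2 * n).+1.
HB.instance Definition _ := GRing.Algebra.on spinor.
HB.instance Definition _ := Vector.on spinor.

Definition y_ (q : nat) : spinor := cliff_gen (0 : C) (inord q.-1).

Definition contract (q : nat) (eta : spinor) : spinor :=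
  let q0 : 'I_(2 * n).+1 := inord q.-1 in
  [ffun B : {set 'I_(2 * n).+1} =>
     if q0 \in B then 0
     else (-1) ^+ #|[set i in B | (i < q0)%N]%SET| * eta (q0 |: B)%SET].

Definition act_x (q : nat) (eta : spinor) : spinor :=
  ('i * sqrtC 2) *: contract q eta.
Definition act_y (q : nat) (eta : spinor) : spinor :=
  ('i * sqrtC 2) *: (y_ q * eta).

(* The basis vectors at positions 2q-2 and 2q-1 are u, v with
   y_q = (u + i v) / sqrt 2 and x_q = (u - i v) / sqrt 2, that is
   u = (x_q + y_q) / sqrt 2 and v = i (x_q - y_q) / sqrt 2. *)
Definition act_gen (i : 'I_(4 * n).+2) (eta : spinor) : spinor :=
  let q := (i./2).+1 in
  if odd i then ('i / sqrtC 2) *: (act_x q eta - act_y q eta)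
  else (sqrtC 2)^-1 *: (act_x q eta + act_y q eta).

(* The representation of Cl_{4n+2}: e_A acts by the composite of its
   generators, enum A being increasing. *)
Definition spin_rep (g : cliff (-1 : R) (4 * n).+2) (eta : spinor) : spinor :=
  \sum_A (g A : R)%:C *: foldr act_gen eta (enum A).

Definition invariant_spinor (s : 'M[quat R]_(1 + n) -> cliff (-1 : R) (4 * n).+2)
    (eta : spinor) : Prop :=
  forall h, U1Sp h -> spin_rep (s h) eta = eta.

Definition omega : spinor := \sum_(1 <= p < n.+1) y_ (2 * p) * y_ (2 * p).+1.
Definition psi_plus : spinor := omega ^+ (n.+1)./2.
Definition psi_minus : spinor := y_ 1 * omega ^+ (n.-1)./2.

End Spinors.

(* Main.v *)
Require Import Defs.
From mathcomp Require Import all_boot all_order all_algebra complex reals.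
From mathcomp Require Import perm ring lra zify.

(* The isotropy representation commutes with left multiplication by i, so on the
   exterior algebra every lift of h acts as a scalar lambda(h) times the algebra
   automorphism induced by the complex matrix of h on y_1, ..., y_(2n+1): the
   vacuum is the only line killed by all contractions.  This automorphism
   multiplies y_1 and omega by conj(z)^2, where z is the U(1) component of h,
   so omega^((n+1)/2) and y_1 omega^((n-1)/2) are both multiplied by
   chi(h) = lambda(h) conj(z)^(n+1).  A bilinear form for which Clifford vectors
   are self-adjoint, hence Spin-invariant, pairs 1 with y_1 omega^n; its
   invariance gives chi(h)^2 = 1.  As H is generated by squares (quaternionic
   quasi-reflections have square roots), chi = 1.
   Conversely, an invariant spinor pairs to zero with each monomial that is an
   eigenvector of some h with eigenvalue other than 1: the diagonal elements of
   Sp(n) with entries 1 and i leave only monomials in y_1 and the products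
   y_(2p) y_(2p+1), an element of infinite order in U(1) leaves only those of
   weight n+1, and transpositions in Sp(n) make the remaining coefficients
   depend on the y_1-degree alone. *)

Set Implicit Arguments.
Unset Strict Implicit.
Unset Printing Implicit Defensive.

Import Order.TTheory GRing.Theory Num.Theory.
Local Open Scope ring_scope.

(** * Monomials of the Clifford algebra *)

Section CliffBasis.
Variables (K : comNzRingType) (q : K) (m : nat).
Implicit Types (A B : {set 'I_m}) (x y : cliff q m).

Lemma symdiffC A B : symdiff A B = symdiff B A.
Proof. by apply/setP => i; rewrite !in_symdiff addbC. Qed.

Lemma in_symdiff1 (i j : 'I_m) A : (j \in symdiff [set i] A) = (j == i) (+) (j \in A).
Proof. by rewrite in_symdiff inE. Qed.

Lemma cliff_base_mulE A x B :
  (cliff_base q A * x) B = cliff_coef q A (symdiff A B) * x (symdiff A B).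
Proof.
rewrite [LHS]cliff_mulE (bigD1 A) //= big1 => [|C nC].
  by rewrite addr0 ffunE eqxx mulr1.
by rewrite ffunE (negPf nC) mulr0 mul0r.
Qed.

Lemma cliff_base_mul A B :
  cliff_base q A * cliff_base q B = cliff_coef q A B *: cliff_base q (symdiff A B).
Proof.
apply/ffunP => C; rewrite cliff_base_mulE !ffunE.
rewrite -[C in RHS](symdiffK A) (can_eq (symdiffK A)).
case: eqP => [->|_]; rewrite /GRing.scale /=; by rewrite ?mulr1 ?mulr0.
Qed.

Lemma cliff_base_sum x : x = \sum_A x A *: cliff_base q A.
Proof.
apply/ffunP => B; rewrite sum_ffunE (bigD1 B) //= big1 => [|A nA].
  by rewrite !ffunE eqxx addr0 [RHS]mulr1.
by rewrite !ffunE eq_sym (negPf nA) [LHS]mulr0.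
Qed.

Lemma cliff_oneE : 1 = cliff_base q set0 :> cliff q m.
Proof. by []. Qed.

Lemma cliff_gen_mul_base i A : cliff_gen q i * cliff_base q A =
  cliff_coef q [set i] A *: cliff_base q (symdiff [set i] A).
Proof. exact: cliff_base_mul. Qed.

(** The sign from moving the generator [i] into increasing position, past the generators of [A] that
    precede it. *)
Definition koszul i A : K := \prod_(j in A) (if (j < i)%N then -1 else 1).

Lemma koszul_sqr i A : koszul i A * koszul i A = 1.
Proof.
by rewrite -big_split big1 //= => j _; case: ltnP => _; rewrite ?mulrNN mulr1.
Qed.

Lemma koszulE i A : koszul i A = (-1) ^+ #|[set j in A | (j < i)%N]|.
Proof.
rewrite -prodr_const /koszul -big_mkcondr /=; apply: eq_bigl => j.
by rewrite inE.
Qed.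

Lemma koszul_flip i j A :
  koszul i (symdiff [set j] A) = koszul i A * (if (j < i)%N then -1 else 1).
Proof.
rewrite /koszul big_mkcond [in RHS]big_mkcond (bigD1 j) //= [in RHS](bigD1 j) //=.
rewrite in_symdiff1 eqxx /=.
rewrite [X in _ * X](eq_bigr
    (fun k => if k \in A then if (k < i)%N then -1 else 1 else 1)).
  by case: (j \in A); case: ltnP => _ /=; ring.
by move=> k /negPf kj; rewrite in_symdiff1 kj.
Qed.

Lemma cliff_coef1 i A :
  cliff_coef q [set i] A = koszul i A * (if i \in A then q else 1).
Proof.
rewrite /cliff_coef big_set1 /koszul.
rewrite (eq_bigr (fun j : 'I_m => (if (j < i)%N then -1 else 1) *
   (if i == j then q else 1))); last first.
  move=> j _; case: (altP (i =P j)) => [->|nij]; first by rewrite ltnn mul1r.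
  by rewrite mulr1; case: ltngtP => // /val_inj /eqP; rewrite (negPf nij).
rewrite big_split; congr (_ * _); rewrite -big_mkcondr /=.
case: ifP => iA; last by rewrite big1 // => j /andP[jA /eqP ij]; rewrite ij jA in iA.
rewrite (big_pred1 i) // => j; rewrite /= eq_sym.
by case: eqP => [->|]; rewrite ?iA ?andbF.
Qed.

End CliffBasis.

(** [P] and [Q] do not depend on [A], so the enumerations of [A] and of [symdiff [set i] A] can be
    compared piece by piece. *)
Lemma enum_ord_split (m : nat) (i : 'I_m) : exists P Q : seq 'I_m,
  [/\ all (fun j : 'I_m => (j < i)%N) P, all (fun j : 'I_m => (i < j)%N) Q &
   forall A : {set 'I_m},
     enum A = filter (mem A) P ++ nseq (i \in A) i ++ filter (mem A) Q].
Proof.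
have S : pairwise (fun j k : 'I_m => (j < k)%N) (enum 'I_m).
  have : pairwise ltn (map val (enum 'I_m)).
    by rewrite -(sorted_pairwise ltn_trans) val_enum_ord iota_ltn_sorted.
  by rewrite pairwise_map.
have E (A : {set 'I_m}) : enum A = filter (mem A) (enum 'I_m).
  by rewrite enumT /enum_mem.
move: S E; case/splitPr: (mem_enum 'I_m i : i \in enum 'I_m) => P Q.
rewrite pairwise_cat /= allrel_consr => /and4P[/andP[lP _] _ gQ _] E.
exists P, Q; split=> // A; rewrite E filter_cat /=; congr (_ ++ _).
by case: (i \in A).
Qed.

(** Multiplying on the left by a generator smaller than all others produces no sign, so the
    increasing product builds up the monomial. *)
Lemma cliff_base_prod (K : comNzRingType) (q : K) (m : nat) (A : {set 'I_m}) :
  cliff_base q A = \prod_(i <- enum A) cliff_gen q i.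
Proof.
have S : pairwise (fun j k : 'I_m => (j < k)%N) (enum A).
  have : pairwise ltn (map val (enum 'I_m)).
    by rewrite -(sorted_pairwise ltn_trans) val_enum_ord iota_ltn_sorted.
  rewrite pairwise_map => S; rewrite /enum_mem -enumT.
  by apply: (subseq_pairwise _ S); apply: filter_subseq.
rewrite -{1}[A]set_enum; elim: (enum A) S => [_|i s IHs /= /andP[/allP lt_is S]].
  by rewrite big_nil cliff_oneE; congr cliff_base; apply/setP => i; rewrite !inE.
have nis : i \notin s by apply/negP => /lt_is; rewrite ltnn.
rewrite big_cons -(IHs S) // cliff_gen_mul_base cliff_coef1 inE (negPf nis) mulr1.
rewrite /koszul big1 => [|j]; last first.
  by rewrite inE => /lt_is; case: ltngtP.
rewrite scale1r; congr cliff_base; apply/setP => j; rewrite in_symdiff1 !inE.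
by case: eqP => [->|]; rewrite ?(negPf nis).
Qed.

(** * Operators satisfying the Clifford relations *)

Section CliffordModule.
Variables (K : comNzRingType) (m : nat) (V : lmodType K) (f : 'I_m -> V -> V).
Hypothesis fZ : forall i c v, f i (c *: v) = c *: f i v.
Hypothesis f_sqr : forall i v, f i (f i v) = - v.
Hypothesis f_anti : forall i j v, i != j -> f i (f j v) = - f j (f i v).

Let fN i v : f i (- v) = - f i v.
Proof. by rewrite -scaleN1r fZ scaleN1r. Qed.

Lemma foldr_anticomm i s v : i \notin s ->
  f i (foldr f v s) = (-1) ^+ size s *: foldr f (f i v) s.
Proof.
elim: s => [|j s IHs] /=; first by rewrite scale1r.
rewrite inE negb_or => /andP[ij nis]; rewrite f_anti // IHs // fZ -scaleN1r.
by rewrite scalerA exprS.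
Qed.

(** Moving [f i] past the smaller generators of [A] gives the Koszul sign; there it is either
    inserted or cancels against itself with square -1. This is the rule for multiplying a monomial
    by a generator, so the operators define a representation. *)
Lemma foldr_flip i (A : {set 'I_m}) v : f i (foldr f v (enum A)) =
  cliff_coef (-1) [set i] A *: foldr f v (enum (symdiff [set i] A)).
Proof.
have [P [Q [ltP gtQ E]]] := enum_ord_split i.
rewrite cliff_coef1 !E !foldr_cat foldr_anticomm; last first.
  by rewrite mem_filter; apply/negP => /andP[_ /(allP ltP)]; rewrite ltnn.
have Ef (s : seq 'I_m) : i \notin s ->
    filter (mem (symdiff [set i] A)) s = filter (mem A) s.
  move=> nis; apply: eq_in_filter => j js; rewrite /= in_symdiff1.
  by case: eqP => // ji; rewrite -ji js in nis.
have nP : i \notin P by apply/negP => /(allP ltP); rewrite ltnn.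
have nQ : i \notin Q by apply/negP => /(allP gtQ); rewrite ltnn.
rewrite !Ef //.
have -> : (-1) ^+ size (filter (mem A) P) = koszul K i A.
  rewrite /koszul -big_enum E !big_cat /= [X in _ * (X * _)]big1_seq; last first.
    by move=> j /andP[_ /nseqP[-> _]]; rewrite ltnn.
  rewrite [X in _ * (_ * X)]big1_seq; last first.
    move=> j /andP[_]; rewrite mem_filter => /andP[_ /(allP gtQ)].
    by case: ltngtP.
  rewrite !mulr1; have : all (fun j : 'I_m => (j < i)%N) (filter (mem A) P).
    by apply/allP => j; rewrite mem_filter => /andP[_ /(allP ltP)].
  elim: (filter _ P) => [|j s IHs]; first by rewrite big_nil.
  by move=> /= /andP[ji /IHs e]; rewrite big_cons ji exprS e.
rewrite in_symdiff1 eqxx /=; case: (i \in A) => /=; last by rewrite mulr1.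
rewrite f_sqr mulrN1 scaleNr -scalerN; congr (_ *: _).
elim: (filter _ P) => //= j s ->; exact: fN.
Qed.

End CliffordModule.

(** * The Clifford action on spinors *)

Section Act.
Variables (R : realType) (n : nat).
Local Notation C := R[i]%C.
Local Notation I := 'I_(2 * n).+1.
Implicit Types (eta : spinor R n) (B : {set I}).

Definition gen (q : I) : spinor R n := cliff_gen (0 : C) q.
(** Written with [symdiff], a union here because [q] is not in [B], so that contraction and wedging
    read the same coefficient of [eta]. *)
Definition ctr (q : I) eta : spinor R n :=
  [ffun B : {set I} => if q \in B then 0
     else koszul C q B * eta (symdiff [set q] B)].

Definition scoef eta B : C := eta B.

Lemma scoefP eta1 eta2 : scoef eta1 =1 scoef eta2 -> eta1 = eta2.
Proof. by move=> eq12; apply/ffunP. Qed.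

Lemma scoefD eta1 eta2 B : scoef (eta1 + eta2) B = scoef eta1 B + scoef eta2 B.
Proof. by rewrite /scoef ffunE. Qed.

Lemma scoefN eta B : scoef (- eta) B = - scoef eta B.
Proof. by rewrite /scoef ffunE. Qed.

Lemma scoefZ c eta B : scoef (c *: eta) B = c * scoef eta B.
Proof. by rewrite /scoef ffunE. Qed.

Lemma scoef0 B : scoef 0 B = 0.
Proof. by rewrite /scoef ffunE. Qed.

Lemma scoef_sum (J : Type) (r : seq J) P (F : J -> spinor R n) B :
  scoef (\sum_(j <- r | P j) F j) B = \sum_(j <- r | P j) scoef (F j) B.
Proof. by apply: (big_morph (scoef^~ B)) => [e1 e2|]; rewrite (scoefD, scoef0). Qed.

Lemma scoef_base A B : scoef (cliff_base 0 A) B = (B == A)%:R.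
Proof. by rewrite /scoef ffunE. Qed.

Lemma scoef_gen q eta B : scoef (gen q * eta) B =
  if q \in B then koszul C q B * scoef eta (symdiff [set q] B) else 0.
Proof.
rewrite /scoef cliff_base_mulE cliff_coef1 koszul_flip ltnn mulr1 in_symdiff1 eqxx /=.
by case: (q \in B); rewrite /= ?mulr1 // mulr0 mul0r.
Qed.

Lemma scoef_ctr q eta B : scoef (ctr q eta) B =
  if q \in B then 0 else koszul C q B * scoef eta (symdiff [set q] B).
Proof. by rewrite /scoef ffunE. Qed.

Lemma contractE q eta : contract q eta = ctr (inord q.-1) eta.
Proof.
apply/ffunP => B; rewrite !ffunE; case: ifP => // qB.
rewrite koszulE; congr (_ * eta _); apply/setP => j.
by rewrite in_symdiff1 !inE; case: eqP => [->|]; rewrite ?qB.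
Qed.

Definition half_ord (i : 'I_(4 * n).+2) : I := inord i./2.

(** A basis vector permutes the monomials up to scalars: at [B] only wedging contributes if
    [half_ord i] lies in [B], and only contraction otherwise. *)
Definition act_coef (i : 'I_(4 * n).+2) B : C :=
  (if odd i then - (-1) ^+ (half_ord i \in B) else 'i) * koszul C (half_ord i) B.

Lemma scoef_act_gen i eta B :
  scoef (act_gen i eta) B = act_coef i B * scoef eta (symdiff [set half_ord i] B).
Proof.
have s2 : sqrtC (2 : C) != 0 by rewrite sqrtC_eq0 pnatr_eq0.
have ii : 'i * 'i = -1 :> C by rewrite -expr2 sqrCi.
rewrite /act_gen /act_x /act_y /act_coef contractE -/(half_ord i).
have -> : y_ R n i./2.+1 = gen (half_ord i) by [].
set q := half_ord i; set k := koszul C q B; set x := scoef eta (symdiff [set q] B).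
case: (odd i); rewrite -?scalerBr -?scalerDr scalerA scoefZ;
  rewrite scoefD ?scoefN scoef_gen scoef_ctr -/k -/x; case: (q \in B) => /=.
- transitivity (- ('i * 'i) * (sqrtC 2 / sqrtC 2) * (k * x) : C); first by ring.
  by rewrite ii divff //; ring.
- transitivity (('i * 'i) * (sqrtC 2 / sqrtC 2) * (k * x) : C); first by ring.
  by rewrite ii divff //; ring.
- transitivity ('i * (sqrtC 2 / sqrtC 2) * (k * x) : C); first by ring.
  by rewrite divff //; ring.
- transitivity ('i * (sqrtC 2 / sqrtC 2) * (k * x) : C); first by ring.
  by rewrite divff //; ring.
Qed.

(* [act_gen] and [spin_rep] are locked because unification diverges when it
   unfolds them; [scoef] hides the finite-function application for the same
   reason. *)
Fact act_key : unit. Proof. exact: tt. Qed.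
Definition act : 'I_(4 * n).+2 -> spinor R n -> spinor R n :=
  locked_with act_key (@act_gen R n).

Lemma actE i eta : act i eta = act_gen i eta.
Proof. by rewrite /act unlock. Qed.

Lemma scoef_act i eta B :
  scoef (act i eta) B = act_coef i B * scoef eta (symdiff [set half_ord i] B).
Proof. by rewrite actE scoef_act_gen. Qed.

Lemma actD i eta1 eta2 : act i (eta1 + eta2) = act i eta1 + act i eta2.
Proof. by apply/scoefP => B; rewrite scoefD !scoef_act scoefD mulrDr. Qed.

Lemma actZ i (c : C) eta : act i (c *: eta) = c *: act i eta.
Proof. by apply/scoefP => B; rewrite scoefZ !scoef_act scoefZ mulrCA. Qed.

Lemma act0 i : act i (0 : spinor R n) = 0.
Proof. by rewrite -(scale0r 0) actZ !scale0r. Qed.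

Lemma act_sqr i eta : act i (act i eta) = - eta.
Proof.
apply/scoefP => B; rewrite scoefN !scoef_act symdiffK mulrA /act_coef.
rewrite koszul_flip ltnn in_symdiff1 eqxx mulr1 mulrACA koszul_sqr mulr1.
have ii : 'i * 'i = -1 :> C by rewrite -expr2 sqrCi.
by case: (odd i); case: (half_ord i \in B) => /=; rewrite ?ii; ring.
Qed.

Lemma act_anti (i j : 'I_(4 * n).+2) eta : i != j ->
  act i (act j eta) = - act j (act i eta).
Proof.
move=> nij; apply/scoefP => B; rewrite scoefN !scoef_act !mulrA -mulNr.
rewrite !symdiffA [X in symdiff X B]symdiffC; congr (_ * _).
rewrite /act_coef !koszul_flip !in_symdiff1.
have hE (k : 'I_(4 * n).+2) : half_ord k = k./2 :> nat.
  rewrite inordK //; have := ltn_ord k.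
  by rewrite -ltn_double; have := odd_double_half k; lia.
(* For two vectors of one pair the odd one changes sign when the even one toggles the common
   generator. For distinct pairs, only the Koszul sign of the larger generator notices the toggling
   of the smaller. *)
have [eq_h|neq_h] := eqVneq (half_ord i) (half_ord j).
  have : odd i != odd j.
    apply: contra nij => /eqP eo; apply/eqP/val_inj => /=.
    by rewrite -[val i]odd_double_half -[val j]odd_double_half eo -!hE eq_h.
  rewrite eq_h ltnn.
  by case: (odd i); case: (odd j) => // _; case: (half_ord j \in B) => /=; ring.
rewrite /=.
have : half_ord i != half_ord j :> nat by rewrite (inj_eq val_inj).
by case: (ltngtP (half_ord i) (half_ord j)) => // _ _;
  move: (koszul _ _ _) (koszul _ _ _) (if odd i then _ else _)
    (if odd j then _ else _) => x y z w; ring.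
Qed.

(* The sign (-1)^q is the one for which both wedging with and contracting by a
   generator are self-adjoint. *)
Definition pol eta1 eta2 : C :=
  \sum_(A : {set I}) (\prod_(q in A) (-1) ^+ q) * scoef eta1 A * scoef eta2 (~: A).

Lemma twist_flip (q : I) B : \prod_(j in symdiff [set q] B) ((-1) ^+ j : C) =
  (\prod_(j in B) (-1) ^+ j) * (-1) ^+ q.
Proof.
rewrite big_mkcond [in RHS]big_mkcond (bigD1 q) //= [in RHS](bigD1 q) //=.
rewrite in_symdiff1 eqxx /=.
rewrite [X in _ * X](eq_bigr (fun k : I => if k \in B then (-1) ^+ k else 1)).
  case: (q \in B) => /=; last by ring.
  by rewrite mulrAC -expr2 sqrr_sign.
by move=> k /negPf kj; rewrite in_symdiff1 kj.
Qed.

(** Exactly [q] generators lie below [q], and they are shared between [B] and its complement. *)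
Lemma koszul_setC (q : I) B : koszul C q (~: B) = koszul C q B * (-1) ^+ q.
Proof.
have E : koszul C q B * koszul C q (~: B) = (-1) ^+ q.
  rewrite /koszul [X in _ * X](eq_bigl (fun j => j \notin B)) => [|j];
    last by rewrite inE.
  rewrite -(bigID (mem B) predT) /= -big_mkcond /=.
  by rewrite -(big_ord_widen _ (fun=> -1)) ?prodr_const ?card_ord // ltnW.
by rewrite -E mulrA koszul_sqr mul1r.
Qed.

Lemma pol_act i eta1 eta2 : pol (act i eta1) eta2 = pol eta1 (act i eta2).
Proof.
(* Toggling the generator in the summation index moves the action to the other argument: the sign
   [(-1) ^+ q] comes from the twist on one side and from [koszul_setC] on the other. *)
rewrite /pol (reindex_inj (can_inj (symdiffK [set half_ord i]))) /=.
apply: eq_bigr => A _; set q := half_ord i.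
have -> : ~: symdiff [set q] A = symdiff [set q] (~: A).
  by apply/setP => j; rewrite !inE; case: (j == q); case: (j \in A).
rewrite !scoef_act symdiffK twist_flip /act_coef -/q koszul_setC koszul_flip ltnn.
rewrite in_symdiff1 eqxx [q \in ~: A]inE /=.
set x := scoef eta1 A; set y := scoef eta2 _; set k := koszul _ _ _.
set u := \prod_(j in A) _; set v := (if odd i then _ else _); set w := (-1) ^+ q.
by move: u v w k x y => u v w k x y; ring.
Qed.

Lemma polZr c eta1 eta2 : pol eta1 (c *: eta2) = c * pol eta1 eta2.
Proof.
by rewrite /pol mulr_sumr; apply: eq_bigr => A _; rewrite scoefZ; ring.
Qed.

Lemma polZl c eta1 eta2 : pol (c *: eta1) eta2 = c * pol eta1 eta2.
Proof.
by rewrite /pol mulr_sumr; apply: eq_bigr => A _; rewrite scoefZ; ring.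
Qed.

Lemma polDl eta1 eta2 eta3 : pol (eta1 + eta2) eta3 = pol eta1 eta3 + pol eta2 eta3.
Proof.
by rewrite /pol -big_split; apply: eq_bigr => A _; rewrite scoefD /=; ring.
Qed.

Lemma polDr eta1 eta2 eta3 : pol eta1 (eta2 + eta3) = pol eta1 eta2 + pol eta1 eta3.
Proof.
by rewrite /pol -big_split; apply: eq_bigr => A _; rewrite scoefD /=; ring.
Qed.

Lemma pol_base B eta :
  pol (cliff_base 0 B) eta = (\prod_(q in B) (-1) ^+ q) * scoef eta (~: B).
Proof.
rewrite /pol (bigD1 B) /= // [X in _ + X]big1 => [|A nA].
  by rewrite scoef_base eqxx mulr1 addr0.
by rewrite scoef_base (negPf nA) mulr0 mul0r.
Qed.

Lemma twist_neq0 B : \prod_(q in B) (-1) ^+ q != 0 :> C.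
Proof. by apply/prodf_neq0 => q _; rewrite signr_eq0. Qed.

Lemma pol_nondeg eta : (forall B, pol (cliff_base 0 B) eta = 0) -> eta = 0.
Proof.
move=> h; apply/scoefP => B; rewrite scoef0; apply/eqP.
have /eqP := h (~: B); rewrite pol_base setCK mulf_eq0 (negPf (twist_neq0 _)).
by [].
Qed.

Local Notation Cl := (cliff (-1 : R) (4 * n).+2).

Lemma cliffDE (K : comNzRingType) (a : K) m (x y : cliff a m) A : (x + y) A = x A + y A.
Proof. by rewrite ffunE. Qed.

Lemma cliffZE (K : comNzRingType) (a : K) m c (x : cliff a m) A : (c *: x) A = c * x A.
Proof. by rewrite ffunE. Qed.

Fact srep_key : unit. Proof. exact: tt. Qed.
Definition srep : Cl -> spinor R n -> spinor R n :=
  locked_with srep_key (@spin_rep R n).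

Lemma spin_repE g eta : spin_rep g eta = srep g eta.
Proof. by rewrite /srep unlock. Qed.

Lemma srepE g eta : srep g eta = \sum_A ((g A : R)%:C)%C *: foldr act eta (enum A).
Proof.
rewrite -spin_repE; apply: eq_bigr => A _; congr (_ *: _).
by elim: (enum A) => //= i s ->; rewrite actE.
Qed.

Lemma srepDl (g h : Cl) eta : srep (g + h) eta = srep g eta + srep h eta.
Proof.
rewrite !srepE -big_split; apply: eq_bigr => A _.
by rewrite cliffDE rmorphD scalerDl.
Qed.

Lemma srepZl c (g : Cl) eta : srep (c *: g) eta = (c%:C)%C *: srep g eta.
Proof.
rewrite !srepE scaler_sumr; apply: eq_bigr => A _.
by rewrite cliffZE rmorphM scalerA.
Qed.

Let foldrD s eta1 eta2 : foldr act (eta1 + eta2) s =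
  foldr act eta1 s + foldr act eta2 s.
Proof. by elim: s => //= i s ->; rewrite actD. Qed.

Let foldrZ s c eta : foldr act (c *: eta) s =
  c *: foldr act eta s.
Proof. by elim: s => //= i s ->; rewrite actZ. Qed.

Lemma srepDr (g : Cl) eta1 eta2 :
  srep g (eta1 + eta2) = srep g eta1 + srep g eta2.
Proof.
rewrite !srepE -big_split; apply: eq_bigr => A _.
by rewrite foldrD scalerDr.
Qed.

Lemma srepZr (g : Cl) c eta : srep g (c *: eta) = c *: srep g eta.
Proof.
rewrite !srepE scaler_sumr; apply: eq_bigr => A _.
by rewrite foldrZ !scalerA mulrC.
Qed.

Lemma srepN (g : Cl) eta : srep g (- eta) = - srep g eta.
Proof. by rewrite -scaleN1r srepZr scaleN1r. Qed.

Lemma srep_base A eta :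
  srep (cliff_base (-1) A) eta = foldr act eta (enum A).
Proof.
rewrite !srepE (bigD1 A) //= big1 => [|B nB].
  by rewrite ffunE eqxx addr0 scale1r.
by rewrite ffunE (negPf nB) scale0r.
Qed.

Lemma srep1 eta : srep (1 : Cl) eta = eta.
Proof. by rewrite cliff_oneE srep_base enum_set0. Qed.

Lemma srep_gen i eta : srep (cliff_gen (-1) i) eta = act i eta.
Proof. by rewrite srep_base enum_set1. Qed.

Lemma srep_suml (J : Type) (r : seq J) P (F : J -> Cl) eta :
  srep (\sum_(j <- r | P j) F j) eta = \sum_(j <- r | P j) srep (F j) eta.
Proof.
apply: (big_morph (fun g => srep g eta)) => [g h|]; first exact: srepDl.
by rewrite -(scale0r (0 : Cl)) srepZl rmorph0 !scale0r.
Qed.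

Lemma srep_sumr (J : Type) (r : seq J) P (F : J -> spinor R n) (g : Cl) :
  srep g (\sum_(j <- r | P j) F j) = \sum_(j <- r | P j) srep g (F j).
Proof.
apply: (big_morph (srep g)) => [eta1 eta2|]; first exact: srepDr.
by rewrite -(scale0r (0 : spinor R n)) srepZr !scale0r.
Qed.

(** On monomials this is [foldr_flip], since the operators [act] satisfy the Clifford relations. *)
Lemma srep_genM i (g : Cl) eta :
  srep (cliff_gen (-1) i * g) eta = act i (srep g eta).
Proof.
rewrite [g]cliff_base_sum mulr_sumr !srep_suml.
rewrite (big_morph (act i) (actD i) (act0 i)).
apply: eq_bigr => A _.
rewrite -scalerAr !srepZl actZ cliff_gen_mul_base srepZl !srep_base.
rewrite (foldr_flip actZ act_sqr act_anti) !scalerA; congr (_ * _ *: _).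
rewrite !cliff_coef1 /koszul rmorphM rmorph_prod; congr (_ * _).
  by apply: eq_bigr => j _; case: ifP; rewrite ?rmorphN rmorph1.
by case: ifP; rewrite ?rmorphN rmorph1.
Qed.

Lemma srepM (g h : Cl) eta : srep (g * h) eta = srep g (srep h eta).
Proof.
have base A : srep (cliff_base (-1) A * h) eta =
    srep (cliff_base (-1) A) (srep h eta).
  rewrite cliff_base_prod; elim: (enum A) => [|i s IHs].
    by rewrite big_nil mul1r srep1.
  by rewrite big_cons -mulrA !srep_genM IHs.
rewrite [g]cliff_base_sum mulr_suml !srep_suml; apply: eq_bigr => A _.
by rewrite -scalerAl !srepZl base.
Qed.

Lemma clvec_sqr (v : 'cV[R]_(4 * n).+2) : clvec v * clvec v = - (\sum_i v i 0 ^+ 2)%:A.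
Proof.
have anti (i j : 'I_(4 * n).+2) : cliff_gen (-1) i * cliff_gen (-1) j +
    cliff_gen (-1) j * cliff_gen (-1) i = (if i == j then -2%:R else 0)%:A :> Cl.
  rewrite !cliff_gen_mul_base symdiffC -scalerDl !cliff_coef1 /koszul !big_set1 !inE.
  have [->|nij] := eqVneq i j.
    rewrite ltnn.
    have -> : symdiff [set j] [set j] = set0.
      by apply/setP => k; rewrite !inE; case: (k == j).
    by rewrite cliff_oneE; congr (_ *: _); ring.
  have : i != j :> nat by rewrite (inj_eq val_inj).
  by case: ltngtP => // _ _; rewrite ?mulr1 ?addrN ?addNr !scale0r.
(* Adding the double sum to itself with the indices exchanged leaves anticommutators of generators,
   which vanish off the diagonal. *)
have two : 2%:R *: (clvec v * clvec v) = 2%:R *: - (\sum_i v i 0 ^+ 2)%:A.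
  have E : clvec v * clvec v = \sum_i \sum_j (v i 0 * v j 0) *:
      (cliff_gen (-1) i * cliff_gen (-1) j).
    rewrite /clvec mulr_suml; apply: eq_bigr => i _; rewrite mulr_sumr.
    by apply: eq_bigr => j _; rewrite -scalerAl -scalerAr scalerA.
  rewrite scaler_nat mulr2n {1}E exchange_big E -big_split /=.
  under eq_bigr => i _.
    rewrite -big_split /=; under eq_bigr => j _ do rewrite mulrC -scalerDr anti.
    rewrite (bigD1 i) //= eqxx big1 => [|j /negPf nji].
      rewrite addr0; over.
    by rewrite nji scale0r scaler0.
  rewrite -scaler_suml -scaleNr !scalerA; congr (_ *: _).
  under [in RHS]eq_bigr => i _ do rewrite expr2.
  by ring.
by apply: (scalerI _ two); rewrite pnatr_eq0.
Qed.

Definition act_vec (v : 'cV[R]_(4 * n).+2) eta : spinor R n :=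
  srep (clvec v) eta.

Lemma act_vecE v eta : act_vec v eta = \sum_i ((v i 0)%:C)%C *: act i eta.
Proof.
rewrite /act_vec /clvec srep_suml; apply: eq_bigr => i _.
by rewrite srepZl srep_gen.
Qed.

Lemma polr_sum (J : Type) (r : seq J) P (F : J -> spinor R n) eta :
  pol eta (\sum_(j <- r | P j) F j) = \sum_(j <- r | P j) pol eta (F j).
Proof.
apply: (big_morph (pol eta)) => [e1 e2|]; first exact: polDr.
by rewrite -(scale0r (0 : spinor R n)) polZr !mul0r.
Qed.

Lemma poll_sum (J : Type) (r : seq J) P (F : J -> spinor R n) eta :
  pol (\sum_(j <- r | P j) F j) eta = \sum_(j <- r | P j) pol (F j) eta.
Proof.
apply: (big_morph (pol^~ eta)) => [e1 e2|]; first exact: polDl.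
by rewrite -(scale0r (0 : spinor R n)) polZl mul0r.
Qed.

Lemma pol_act_vec v eta1 eta2 : pol (act_vec v eta1) eta2 = pol eta1 (act_vec v eta2).
Proof.
rewrite !act_vecE poll_sum polr_sum; apply: eq_bigr => i _.
by rewrite polZl polZr pol_act.
Qed.

(* Vectors are self-adjoint for [pol] and unit vectors square to -1, so a
   product of k unit vectors multiplies [pol] by (-1)^k. *)
Lemma pol_spin (g : Cl) eta1 eta2 : spin_group g ->
  pol (srep g eta1) (srep g eta2) = pol eta1 eta2.
Proof.
case=> vs [even_vs unit_vs ->].
suff -> : pol (srep (\prod_(v <- vs) clvec v) eta1)
    (srep (\prod_(v <- vs) clvec v) eta2) = (-1) ^+ size vs * pol eta1 eta2.
  by rewrite -signr_odd (negPf even_vs) mul1r.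
elim: vs unit_vs {even_vs} => [_|v vs IHs unit_vs].
  by rewrite big_nil !srep1 mul1r.
rewrite big_cons !srepM -!/(act_vec _ _) pol_act_vec /act_vec -srepM.
rewrite clvec_sqr unit_vs ?mem_head // -scaleNr srepZl srep1 polZr.
rewrite IHs => [|u us]; last by rewrite unit_vs // inE us orbT.
by rewrite rmorphN rmorph1 exprS mulrA.
Qed.

(** An isometry of a nondegenerate form is injective. *)
Lemma srep_inj (g : Cl) eta : spin_group g -> srep g eta = 0 -> eta = 0.
Proof.
move=> sg g0; apply: pol_nondeg => B; rewrite -(pol_spin _ _ sg) g0.
by rewrite /pol big1 // => A _; rewrite scoef0 mulr0.
Qed.

(** An injective idempotent is the identity. This handles the lift of the unit, which is only known
    to be multiplicative. *)
Lemma srep_idem (g : Cl) eta : spin_group g -> g * g = g -> srep g eta = eta.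
Proof.
move=> sg gg; apply/eqP; rewrite -subr_eq0; apply/eqP.
apply: (srep_inj sg); rewrite srepDr -scaleN1r srepZr scaleN1r.
by rewrite -srepM gg subrr.
Qed.

End Act.

(** * The isotropy representation *)

Section Quaternions.
Variable R : comNzRingType.
Implicit Types x y : quat R.

Lemma quatP x y : [/\ qre x = qre y, qi x = qi y, qj x = qj y & qk x = qk y] -> x = y.
Proof. by case: x y => ? ? ? ? [? ? ? ?] /= [-> -> -> ->]. Qed.

Lemma quatDE x y : x + y = Defs.addq x y. Proof. by []. Qed.
Lemma quatNE x : - x = Defs.oppq x. Proof. by []. Qed.
Lemma quatME x y : x * y = Defs.mulq x y. Proof. by []. Qed.
Lemma quat0E : 0 = Quat 0 0 0 0 :> quat R. Proof. by []. Qed.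
Lemma quat1E : 1 = Quat 1 0 0 0 :> quat R. Proof. by []. Qed.

Definition quatE := (quatDE, quatNE, quatME, quat0E, quat1E).

Lemma conjqD x y : conjq (x + y) = conjq x + conjq y.
Proof. by apply: quatP; rewrite !quatE; split=> /=; ring. Qed.

Lemma conjq0 : conjq 0 = 0 :> quat R.
Proof. by rewrite quat0E /conjq /= oppr0. Qed.

Lemma conjq1 : conjq 1 = 1 :> quat R.
Proof. by rewrite quat1E /conjq /= oppr0. Qed.

Lemma conjqM x y : conjq (x * y) = conjq y * conjq x.
Proof. by apply: quatP; rewrite !quatE; split=> /=; ring. Qed.

Lemma conjqK : involutive (@conjq R).
Proof. by case=> a b c d; rewrite /conjq /= !opprK. Qed.

Lemma conjq_sum (J : Type) (r : seq J) (F : J -> quat R) :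
  conjq (\sum_(j <- r) F j) = \sum_(j <- r) conjq (F j).
Proof. exact: (big_morph (@conjq R) conjqD conjq0). Qed.

Lemma adjqE (m k : nat) (A : 'M[quat R]_(m, k)) i j : adjq A i j = conjq (A j i).
Proof. by rewrite !mxE. Qed.

Lemma adjqK (m k : nat) (A : 'M[quat R]_(m, k)) : adjq (adjq A) = A.
Proof. by apply/matrixP => i j; rewrite !adjqE conjqK. Qed.

Lemma adjqM (m k l : nat) (A : 'M[quat R]_(m, k)) (B : 'M[quat R]_(k, l)) :
  adjq (A *m B) = adjq B *m adjq A.
Proof.
apply/matrixP => i j; rewrite adjqE !mxE conjq_sum; apply: eq_bigr => r _.
by rewrite conjqM !adjqE.
Qed.

Lemma conj_delta (m : nat) (h : 'M[quat R]_m) (d : quat R) r s i j :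
  (h *m (d *: delta_mx r s) *m adjq h) i j = h i r * d * conjq (h j s).
Proof.
rewrite mxE (bigD1 s) //= big1 => [|l nl]; last first.
  rewrite mxE big1 ?mul0r // => k _.
  by rewrite !mxE (negPf nl) andbF !mulr0.
rewrite addr0 adjqE mxE (bigD1 r) //= big1 => [|k nk]; last first.
  by rewrite !mxE (negPf nk) !mulr0.
by rewrite !mxE !eqxx addr0 mulr1.
Qed.

Lemma tr_delta (m : nat) (Y : 'M[quat R]_m) (c : quat R) i j :
  \tr ((c *: delta_mx i j) *m Y) = c * Y j i.
Proof.
rewrite /mxtrace (bigD1 i) //= big1 => [|k nk]; last first.
  by rewrite mxE big1 // => l _; rewrite !mxE (negPf nk) mulr0 mul0r.
rewrite addr0 mxE (bigD1 j) //= big1 => [|k nk]; last first.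
  by rewrite !mxE (negPf nk) andbF mulr0 mul0r.
by rewrite !mxE !eqxx addr0 mulr1.
Qed.

End Quaternions.

(** * The matrix of the isotropy representation in the oriented frame *)

Section IsotropyMatrix.
Variables (R : realType) (n : nat).
Local Notation M := 'M[quat R]_(1 + n).

(** The frame vectors at positions [2q] and [2q + 1] have first-row entries proportional to
    [qunit q] and [iq * qunit q]; left multiplication by i is thus the complex structure of each
    pair. *)
Definition qunit (q : nat) : quat R :=
  if q == 0%N then - kq else if odd q then jq else iq.
Definition qcol (q : nat) : 'I_(1 + n) := inord q.+1./2.
Definition qpos (q : nat) (d : bool) : 'I_(4 * n).+2 := inord (d + q.*2).
Definition ipow (d : bool) : quat R := if d then iq else 1.

(** Elements of sp(n+1) are skew-Hermitian, so those of the complement are determined by row 0. For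
    [p = ord0] the vertical ones have [c] in the span of j and k. *)
Definition tangent (p : 'I_(1 + n)) (c : quat R) : M :=
  if p == ord0 then c *: delta_mx ord0 ord0
  else c *: delta_mx ord0 p - conjq c *: delta_mx p ord0.

Variables a t : R.

Definition frame_scale (p : 'I_(1 + n)) : R :=
  if p == ord0 then (Num.sqrt (2 * t * a))^-1 else (Num.sqrt (2 * a))^-1.

Lemma qcol_eq0 q : (q < (2 * n).+1)%N -> (qcol q == ord0) = (q == 0%N).
Proof.
move=> q_lt; rewrite -(inj_eq val_inj) /= inordK; last by lia.
by case: q q_lt => [|[|q]].
Qed.

Lemma frameE q d : (q < (2 * n).+1)%N ->
  frame a t (qpos q d) =
  tangent (qcol q) (realq (frame_scale (qcol q)) * (ipow d * qunit q)).
Proof.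
move=> q_lt; rewrite /frame /qpos inordK; last by case: d; lia.
rewrite /tangent /frame_scale qcol_eq0 //.
have [->|q_gt0] := posnP q.
  rewrite /xi_ /mxF eqxx /qunit.
  by case: d => /=; rewrite scalerA; congr (_ *: _); apply: quatP;
    rewrite !quatE; split=> /=; ring.
have -> : (d + q.*2 + 2 < 4)%N = false by case: d; lia.
(* Position [d + q.*2] carries the label [d + q.*2 + 2], whose quotient by 4 gives the column and
   whose remainder gives the unit. *)
rewrite /e_.
have -> : ((d + q.*2 + 2) %/ 4 = q.+1./2)%N by case: d; lia.
have -> : ((d + q.*2 + 2) %% 4 = d + (~~ odd q).*2)%N by case: d; lia.
rewrite -/(qcol q) /mxF eq_sym qcol_eq0 // eqn0Ngt q_gt0 /=.
rewrite /qunit eqn0Ngt q_gt0 /= /Defs.mxE.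
by case: d; case: (odd q) => /=; apply/matrixP => i j; rewrite !mxE;
  case: (_ && _); case: (_ && _); apply: quatP; rewrite !quatE; split=> /=; ring.
Qed.

Lemma B0_delta c i j (Y : M) : B0 (c *: delta_mx i j) Y = - qre (c * Y j i).
Proof. by rewrite /B0 tr_delta. Qed.

Lemma B0B (X Y Z : M) : B0 (X - Y) Z = B0 X Z - B0 Y Z.
Proof. by rewrite /B0 mulmxBl raddfB /= opprD. Qed.

Lemma B00 (Z : M) : B0 0 Z = 0.
Proof. by rewrite /B0 mul0mx mxtrace0 oppr0. Qed.

Lemma vpart_tangent p c : p != ord0 -> vpart (tangent p c) = 0.
Proof.
move=> /negPf p0; apply/matrixP => i j; rewrite !mxE.
case: ifP => // /andP[/eqP-> /eqP->].
by rewrite /tangent p0 !mxE [ord0 == p]eq_sym p0 andbF !mulr0 subr0.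
Qed.

Lemma hpart_tangent p c : p != ord0 -> hpart (tangent p c) = tangent p c.
Proof.
move=> /negPf p0; apply/matrixP => i j; rewrite !mxE /tangent p0 !mxE.
case: (eqVneq i ord0) => [->|i0]; case: (eqVneq j ord0) => [->|j0] //=.
  by rewrite [ord0 == p]eq_sym p0 !mulr0 subr0.
by rewrite andbF !mulr0 subr0.
Qed.

Lemma hpart_tangent0 c : hpart (tangent ord0 c) = 0.
Proof.
apply/matrixP => i j; rewrite /tangent eqxx !mxE.
by case: (i == ord0); case: (j == ord0) => //=; rewrite mulr0.
Qed.

Lemma vpart_tangent0 c : qre c = 0 -> qi c = 0 -> vpart (tangent ord0 c) = tangent ord0 c.
Proof.
move=> c0 c1; apply/matrixP => i j; rewrite /tangent eqxx !mxE.
case: (i == ord0); case: (j == ord0); rewrite /= ?mulr0 ?mulr1 //.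
by apply: quatP; split; rewrite /= ?c0 ?c1; ring.
Qed.

Lemma metric_tangent0 c (X : M) : qre c = 0 -> qi c = 0 ->
  metric a t (tangent ord0 c) X = 2 * a * t * qre (X ord0 ord0 * conjq c).
Proof.
move=> c0 c1; rewrite /metric hpart_tangent0 B00 mulr0 add0r vpart_tangent0 //.
rewrite /tangent eqxx B0_delta /vpart mxE /=; congr (_ * _).
by rewrite ?c0 ?c1; ring.
Qed.

(** The two entries of the skew-Hermitian [X] contribute equally to the trace, whence the factor
    2. *)
Lemma metric_tangent p c (X : M) : p != ord0 -> X p ord0 = - conjq (X ord0 p) ->
  metric a t (tangent p c) X = 2 * a * qre (X ord0 p * conjq c).
Proof.
move=> p0 Xp; rewrite /metric vpart_tangent // B00 mulr0 addr0 hpart_tangent //.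
rewrite /tangent (negPf p0) B0B !B0_delta !mxE (negPf p0) eqxx /= Xp.
by rewrite !quatE /=; ring.
Qed.

Lemma U1Sp_entries (h : M) : U1Sp h -> [/\ U1 (h ord0 ord0),
  forall p, p != ord0 -> h ord0 p = 0 & forall p, p != ord0 -> h p ord0 = 0].
Proof.
have o0 : ord0 = lshift n (ord0 : 'I_1) by apply/val_inj.
case=> z [A [Uz _ ->]]; split.
- by rewrite o0 block_mxEul !mxE eqxx mulr1n.
- move=> p; rewrite o0; case: (@split_ordP 1 n p) => k ->.
    by rewrite ord1 eqxx.
  by rewrite block_mxEur mxE.
move=> p; rewrite o0; case: (@split_ordP 1 n p) => k ->.
  by rewrite ord1 eqxx.
by rewrite block_mxEdl mxE.
Qed.

Lemma conj_tangent h q d p : U1Sp h ->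
  (h *m tangent q d *m adjq h) ord0 p =
    h ord0 ord0 * d * conjq (h p q) /\
  (p != ord0 -> (h *m tangent q d *m adjq h) p ord0 =
    - conjq (h ord0 ord0 * d * conjq (h p q))).
Proof.
move=> /U1Sp_entries[_ h0 h1]; rewrite /tangent; have [->|q0] := eqVneq q ord0.
  rewrite !conj_delta; split=> // p0.
  by rewrite (h1 p p0) conjq0 !mulr0 conjq0 oppr0 !mul0r.
have E i j : (h *m (d *: delta_mx ord0 q - conjq d *: delta_mx q ord0) *m adjq h) i j =
    h i ord0 * d * conjq (h j q) - h i q * conjq d * conjq (h j ord0).
  by rewrite mulmxBr mulmxBl -!conj_delta [LHS]mxE [X in _ + X]mxE.
rewrite !E (h0 _ q0) !mul0r subr0; split=> // p0.
by rewrite (h1 p p0) !mul0r sub0r !conjqM conjqK mulrA.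
Qed.

Lemma realqM (r : R) (x : quat R) :
  [/\ qre (realq r * x) = r * qre x, qi (realq r * x) = r * qi x,
      qj (realq r * x) = r * qj x & qk (realq r * x) = r * qk x].
Proof. by rewrite !quatE; split=> /=; ring. Qed.

Lemma frame_scale_sqr p : 0 < a -> 0 < t ->
  (if p == ord0 then 2 * a * t else 2 * a) * frame_scale p ^+ 2 = 1.
Proof.
move=> a0 t0; rewrite /frame_scale.
have [p0|p0] := eqVneq p ord0; rewrite exprVn sqr_sqrtr.
- have -> : 2 * a * t = 2 * t * a by ring.
  by rewrite mulfV // !mulf_neq0 ?gt_eqF.
- by rewrite !mulr_ge0 // ltW.
- by rewrite mulfV // !mulf_neq0 ?gt_eqF.
by rewrite !mulr_ge0 // ltW.
Qed.

(** The parameters disappear: within V or within H the two frame scales cancel the weight of the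
    metric, and between V and H the entry of the block-diagonal [h] vanishes. *)
Lemma isotropyE h p q (e d : bool) : 0 < a -> 0 < t -> U1Sp h ->
  (p < (2 * n).+1)%N -> (q < (2 * n).+1)%N ->
  isotropy a t h (qpos p e) (qpos q d) =
  qre (h ord0 ord0 * (ipow d * qunit q) * conjq (h (qcol p) (qcol q)) *
       conjq (ipow e * qunit p)).
Proof.
move=> a0 t0 Uh p_lt q_lt; rewrite mxE !frameE //.
set c := ipow e * qunit p; set b := ipow d * qunit q.
have [X1 X2] := conj_tangent (qcol q) (realq (frame_scale (qcol q)) * b) (qcol p) Uh.
have [_ h0 h1] := U1Sp_entries Uh.
have key : metric a t (tangent (qcol p) (realq (frame_scale (qcol p)) * c))
   (h *m tangent (qcol q) (realq (frame_scale (qcol q)) * b) *m adjq h) =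
   (if qcol p == ord0 then 2 * a * t else 2 * a) *
   qre (h ord0 ord0 * (realq (frame_scale (qcol q)) * b) * conjq (h (qcol p) (qcol q)) *
    conjq (realq (frame_scale (qcol p)) * c)).
  have [p0|p0] := eqVneq (qcol p) ord0; last by rewrite metric_tangent ?X2 // X1.
  have cE : qre c = 0 /\ qi c = 0.
    rewrite /c /qunit; move/eqP: p0; rewrite qcol_eq0 // => ->.
    by case: (e); rewrite !quatE; split=> /=; ring.
  rewrite p0 in X1 *; rewrite metric_tangent0 ?X1 //.
    by have [-> _ _ _] := realqM (frame_scale ord0) c; rewrite cE.1 mulr0.
  by have [_ -> _ _] := realqM (frame_scale ord0) c; rewrite cE.2 mulr0.
rewrite {}key; have sq := frame_scale_sqr (qcol p) a0 t0.
have [eq_pq|neq_pq] := eqVneq (qcol p == ord0) (qcol q == ord0).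
  have -> : frame_scale (qcol q) = frame_scale (qcol p) by rewrite /frame_scale eq_pq.
  rewrite -[RHS]mul1r -[X in _ = X * _]sq {X1 X2 sq}.
  move: (h _ _) (h _ _) b c (frame_scale _) (if _ then _ else _) => x y b' c' f g.
  by rewrite !quatE /=; ring.
have -> : h (qcol p) (qcol q) = 0.
  have [p0|p0] := eqVneq (qcol p) ord0; have [q0|q0] := eqVneq (qcol q) ord0.
  - by rewrite p0 q0 eqxx in neq_pq.
  - by rewrite p0 h0.
  - by rewrite q0 h1.
  - by rewrite (negPf p0) (negPf q0) eqxx in neq_pq.
by rewrite conjq0 !mulr0 !mul0r mulr0.
Qed.

(* Matrix entry of [h] on the antiholomorphic vectors y_1, ..., y_(2n+1): a
   unit quaternion of U(1) commutes with i, so [h] is complex linear. *)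
Definition uentry (h : M) (p q : nat) : R[i]%C :=
  let w := h ord0 ord0 * qunit q * conjq (h (qcol p) (qcol q)) * conjq (qunit p) in
  Complex (qre w) (- qi w).

(** The U(1) component commutes with i, so each real 2 x 2 block commutes with the complex structure
    and acts on [u + i v] as the complex number [uentry h p q]. *)
Lemma isotropy_uentry h p q : 0 < a -> 0 < t -> U1Sp h ->
  (p < (2 * n).+1)%N -> (q < (2 * n).+1)%N ->
  [/\ isotropy a t h (qpos p false) (qpos q false) = complex.Re (uentry h p q),
      isotropy a t h (qpos p true) (qpos q true) = complex.Re (uentry h p q),
      isotropy a t h (qpos p true) (qpos q false) = - complex.Im (uentry h p q) &
      isotropy a t h (qpos p false) (qpos q true) = complex.Im (uentry h p q)].
Proof.
move=> a0 t0 Uh p_lt q_lt; rewrite !isotropyE // /uentry /ipow.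
have [[zj zk _] _ _] := U1Sp_entries Uh.
move: (h _ _) (h _ _) (qunit p) (qunit q) zj zk => z x b c zj zk.
by rewrite !quatE /= zj zk; split; ring.
Qed.

End IsotropyMatrix.

(** * Lifting isotropy elements to spinors *)

Section ComplexPairs.
Variables (R : rcfType) (V : lmodType R[i]%C) (u : R[i]%C) (v w : V).

(** For [v] and [w] the wedge and the contraction of a spinor by one generator, the two brackets are
    the contributions of that pair to the images of an odd and an even frame vector. Complex
    linearity makes the contraction cancel. *)
Lemma pair_creation :
  (((complex.Im u)%:C)%C *: ('i *: (v + w)) + ((complex.Re u)%:C)%C *: (v - w)) -
    'i *: (((complex.Re u)%:C)%C *: ('i *: (v + w)) +
           ((- complex.Im u)%:C)%C *: (v - w)) = 2%:R *: (u *: v).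
Proof.
have ii : 'i * 'i = -1 :> R[i]%C by rewrite -expr2 sqrCi.
have uE : u = ((complex.Re u)%:C)%C + 'i * ((complex.Im u)%:C)%C.
  by rewrite -complexiE -complexE.
set P := v + w; set Q := v - w.
have PQ : P + Q = 2%:R *: v by rewrite /P /Q addrACA subrr addr0 scaler_nat mulr2n.
clearbody P Q.
rewrite scalerDr !scalerA opprD -!scaleNr addrACA -!scalerDl.
set x := ((complex.Re u)%:C)%C in uE *; set y := ((complex.Im u)%:C)%C in uE *.
have -> : y * 'i - 'i * x * 'i = u.
  by rewrite -mulrA (mulrC x) mulrA ii uE; clearbody x y; ring.
have -> : (- complex.Im u)%:C%C = - y by apply: rmorphN.
have -> : x - 'i * - y = u by rewrite uE; clearbody x y; ring.
by rewrite -scalerDr PQ !scalerA mulrC.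
Qed.

Lemma pair_annihilation :
  - (((complex.Im u)%:C)%C *: ('i *: (v + w)) + ((complex.Re u)%:C)%C *: (v - w)) -
    'i *: (((complex.Re u)%:C)%C *: ('i *: (v + w)) +
           ((- complex.Im u)%:C)%C *: (v - w)) = 2%:R *: ((u^*)%C *: w).
Proof.
have ii : 'i * 'i = -1 :> R[i]%C by rewrite -expr2 sqrCi.
have uE : (u^*)%C = ((complex.Re u)%:C)%C - 'i * ((complex.Im u)%:C)%C.
  rewrite -complexiE; case: u => x y; rewrite [LHS]complexE /=.
  by rewrite rmorphN mulrN.
set P := v + w; set Q := v - w.
have PQ : P - Q = 2%:R *: w.
  by rewrite /P /Q opprB addrC addrA subrK scaler_nat mulr2n.
clearbody P Q.
rewrite scalerDr !scalerA !opprD -!scaleNr addrACA -!scalerDl.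
set x := ((complex.Re u)%:C)%C in uE *; set y := ((complex.Im u)%:C)%C in uE *.
have -> : - (y * 'i) - 'i * x * 'i = (u^*)%C.
  by rewrite -mulrA (mulrC x) mulrA ii uE; clearbody x y; ring.
have -> : (- complex.Im u)%:C%C = - y by apply: rmorphN.
have -> : - x - 'i * - y = - (u^*)%C by rewrite uE; clearbody x y; ring.
by rewrite scaleNr -scalerBr PQ !scalerA mulrC.
Qed.

End ComplexPairs.

Section Creation.
Variables (R : realType) (n : nat).
Local Notation C := R[i]%C.
Local Notation I := 'I_(2 * n).+1.
Implicit Types (eta : spinor R n) (q : I).

Lemma half_qpos q d : half_ord (qpos n q d) = q.
Proof.
apply/val_inj; rewrite /half_ord /qpos /= !inordK; case: d; have := ltn_ord q; lia.
Qed.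

Lemma odd_qpos q d : odd (qpos n q d) = d.
Proof.
by rewrite /qpos inordK; case: d; have := ltn_ord q; lia.
Qed.

Lemma act_even q eta : act (qpos n q false) eta = 'i *: (gen R q * eta + ctr q eta).
Proof.
apply/scoefP => B; rewrite scoefZ scoefD scoef_act scoef_gen scoef_ctr /act_coef.
rewrite half_qpos odd_qpos; case: ifP => _; ring.
Qed.

Lemma act_odd q eta : act (qpos n q true) eta = gen R q * eta - ctr q eta.
Proof.
apply/scoefP => B; rewrite scoefD scoefN scoef_act scoef_gen scoef_ctr /act_coef.
rewrite half_qpos odd_qpos; case: ifP => _ /=; ring.
Qed.

Lemma gen_mulE q eta : 2%:R *: (gen R q * eta) =
  act (qpos n q true) eta - 'i *: act (qpos n q false) eta.
Proof.
rewrite act_even act_odd scalerA -expr2 sqrCi scaleN1r opprK addrACA.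
by rewrite addNr addr0 scaler_nat mulr2n.
Qed.

Lemma ctr_act q eta : 2%:R *: ctr q eta =
  - act (qpos n q true) eta - 'i *: act (qpos n q false) eta.
Proof.
rewrite act_even act_odd scalerA -expr2 sqrCi scaleN1r opprK opprB.
by rewrite addrA subrK scaler_nat mulr2n.
Qed.

Lemma sum_qpos (V : zmodType) (F : 'I_(4 * n).+2 -> V) :
  \sum_i F i = \sum_(q < (2 * n).+1) (F (qpos n q false) + F (qpos n q true)).
Proof.
have pairs (G : nat -> V) m : \sum_(i < m.*2) G i = \sum_(q < m) (G q.*2 + G q.*2.+1).
  elim: m => [|m IHm]; first by rewrite !big_ord0.
  by rewrite doubleS !big_ord_recr /= IHm addrA.
have e : (4 * n).+2 = (2 * n).+1.*2 by lia.
rewrite (eq_bigr (fun i : 'I_(4 * n).+2 => F (inord i))) => [|i _];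
  last by rewrite inord_val.
rewrite -(big_mkord predT (fun i => F (inord i))) e big_mkord.
exact: (pairs (fun i => F (inord i))).
Qed.

Section Lift.
Variables (a t : R) (a_gt0 : 0 < a) (t_gt0 : 0 < t).
Variable s : 'M[quat R]_(1 + n) -> cliff (-1 : R) (4 * n).+2.
Hypothesis s_lift : isotropy_lift a t s.
Local Notation M := 'M[quat R]_(1 + n).
Implicit Types h : M.

Local Notation T h := (srep (s h)).

Lemma lift_act h j eta : U1Sp h ->
  T h (act j eta) = \sum_i ((isotropy a t h i j)%:C)%C *: act i (T h eta).
Proof.
case: s_lift => _ _ cov _ Uh.
have cl : clvec (delta_mx j 0) = cliff_gen (-1 : R) j.
  rewrite /clvec (bigD1 j) //= big1 => [|i ni]; last first.
    by rewrite mxE (negPf ni) scale0r.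
  by rewrite mxE !eqxx addr0 scale1r.
rewrite -srep_gen -srepM -cl cov // srepM -/(act_vec _ _) act_vecE.
apply: eq_bigr => i _; congr ((_%:C)%C *: _).
rewrite mxE (bigD1 j) //= big1 => [|k nk];
  last by rewrite [X in _ * X]mxE (negPf nk) mulr0.
by rewrite [X in _ * X + _]mxE !eqxx addr0 mulr1.
Qed.

(** The image of y_(q+1) under the complex matrix of [h], as indices start at 0. *)
Definition lift_y h (q : nat) : spinor R n :=
  \sum_(p < (2 * n).+1) uentry h p q *: gen R p.

(** Wedging by a generator is a complex combination of two frame vectors, and [spin_covers] tells
    how the lift moves past each of them. *)
Lemma lift_gen h q eta : U1Sp h -> T h (gen R q * eta) = lift_y h q * T h eta.
Proof.
move=> Uh; have two : 2%:R != 0 :> C by rewrite pnatr_eq0.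
apply: (scalerI two); rewrite -srepZr gen_mulE srepDr srepN srepZr.
rewrite !lift_act // !sum_qpos /lift_y mulr_suml !scaler_sumr -?sumrN -?sumrB -?big_split.
apply: eq_bigr => p _ /=.
have [-> -> -> ->] := isotropy_uentry a_gt0 t_gt0 Uh (ltn_ord p) (ltn_ord q).
rewrite !act_even !act_odd -scalerAl.
exact: pair_creation.
Qed.

Lemma lift_ctr h q eta : U1Sp h -> T h (ctr q eta) =
  \sum_(p < (2 * n).+1) (uentry h p q)^*%C *: ctr p (T h eta).
Proof.
move=> Uh; have two : 2%:R != 0 :> C by rewrite pnatr_eq0.
apply: (scalerI two); rewrite -srepZr ctr_act srepDr !srepN srepZr.
rewrite !lift_act // !sum_qpos !scaler_sumr -?sumrN -?sumrB -?big_split.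
apply: eq_bigr => p _ /=.
have [-> -> -> ->] := isotropy_uentry a_gt0 t_gt0 Uh (ltn_ord p) (ltn_ord q).
by rewrite !act_even !act_odd pair_annihilation.
Qed.

End Lift.
End Creation.

(** * Sp(n) is generated by squares *)

Section Symplectic.
Variable R : comNzRingType.

Lemma SpM (n : nat) (A B : 'M[quat R]_n) : Sp A -> Sp B -> Sp (A *m B).
Proof.
move=> [A1 A2] [B1 B2]; rewrite /Sp adjqM; split.
  by rewrite mulmxA -(mulmxA A) B1 mulmx1.
by rewrite mulmxA -(mulmxA (adjq B)) A2 mulmx1.
Qed.

Lemma Sp_adj (n : nat) (A : 'M[quat R]_n) : Sp A -> Sp (adjq A).
Proof. by move=> [A1 A2]; rewrite /Sp adjqK. Qed.

Lemma adjq1 (n : nat) : adjq 1%:M = 1%:M :> 'M[quat R]_n.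
Proof.
apply/matrixP => i j; rewrite adjqE !mxE eq_sym.
by case: (_ == _); rewrite ?conjq1 ?conjq0.
Qed.

Lemma Sp1 (n : nat) : Sp (1%:M : 'M[quat R]_n).
Proof. by rewrite /Sp adjq1 mulmx1. Qed.

Lemma adjqD (m n : nat) (A B : 'M[quat R]_(m, n)) : adjq (A + B) = adjq A + adjq B.
Proof. by apply/matrixP => i j; rewrite !(adjqE, mxE) conjqD. Qed.

Lemma adjqN (m n : nat) (A : 'M[quat R]_(m, n)) : adjq (- A) = - adjq A.
Proof. by apply/matrixP => i j; rewrite !(adjqE, mxE). Qed.

Lemma adjq_scalar (n : nat) (x : quat R) : adjq (x%:M : 'M_n) = (conjq x)%:M.
Proof.
apply/matrixP => i j; rewrite adjqE !mxE eq_sym.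
by case: (_ == _); rewrite ?mulr1n ?mulr0n ?conjq0.
Qed.

Definition qnorm (x : quat R) : R := qre x ^+ 2 + qi x ^+ 2 + qj x ^+ 2 + qk x ^+ 2.

Lemma mulq_conj x : x * conjq x = realq (qnorm x).
Proof. by apply: quatP; rewrite !quatE /qnorm; split=> /=; ring. Qed.

Lemma mul_conjq x : conjq x * x = realq (qnorm x).
Proof. by apply: quatP; rewrite !quatE /qnorm; split=> /=; ring. Qed.

Lemma realq_sum (J : Type) (r : seq J) (F : J -> R) :
  realq (\sum_(j <- r) F j) = \sum_(j <- r) realq (F j).
Proof.
apply: (big_morph (@realq R)) => // x y.
by apply: quatP; rewrite !quatE; split=> /=; ring.
Qed.

(** The map sending a column [w] to [w - u x <u, w>]; it fixes the vectors orthogonal to [u]. *)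
Definition quasirefl (n : nat) (u : 'cV[quat R]_n) (x : quat R) : 'M[quat R]_n :=
  1%:M - u *m x%:M *m adjq u.

Lemma adj_quasirefl n (u : 'cV[quat R]_n) x :
  adjq (quasirefl u x) = quasirefl u (conjq x).
Proof. by rewrite /quasirefl adjqD adjqN adjq1 !adjqM adjqK adjq_scalar mulmxA. Qed.

(** In terms of [1 - realq N * x] the composition law is multiplication of quaternions. *)
Lemma quasireflM n (u : 'cV[quat R]_n) N x y : adjq u *m u = (realq N)%:M ->
  quasirefl u x *m quasirefl u y = quasirefl u (x + y - x * realq N * y).
Proof.
move=> uu; rewrite /quasirefl mulmxBl mul1mx mulmxBr mulmx1.
have -> : u *m x%:M *m adjq u *m (u *m y%:M *m adjq u) =
    u *m (x * realq N * y)%:M *m adjq u.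
  by rewrite !mulmxA -[_ *m adjq u *m u]mulmxA uu -!(mulmxA u) -!scalar_mxM.
have -> (z : quat R) : (x + y - z)%:M = x%:M + y%:M - z%:M :> 'M_1.
  apply/matrixP => i j; rewrite !mxE.
  by case: (_ == _); rewrite ?mulr1n ?mulr0n ?addr0 ?subr0.
rewrite mulmxBr mulmxDr mulmxBl mulmxDl.
by rewrite -[LHS]addrA -opprD addrA [u *m _ *m _ + _]addrC.
Qed.

(** For nonzero [N] the condition on [x] says that [1 - realq N * x] is a unit quaternion; it makes
    the parameter of the product with the adjoint zero. *)
Lemma quasirefl_Sp n (u : 'cV[quat R]_n) N x : adjq u *m u = (realq N)%:M ->
  qre x + qre x = N * qnorm x -> Sp (quasirefl u x).
Proof.
move=> uu xN; have q0 : quasirefl u 0 = 1%:M.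
  rewrite /quasirefl (_ : _%:M = 0 :> 'M_1) ?mulmx0 ?mul0mx ?subr0 //.
  by apply/matrixP => i j; rewrite !mxE mul0rn.
have e1 : x + conjq x - x * realq N * conjq x = 0.
  have -> : x * realq N * conjq x = realq (N * qnorm x).
    by apply: quatP; rewrite !quatE /qnorm; split=> /=; ring.
  by rewrite -xN; apply: quatP; rewrite !quatE; split=> /=; ring.
have e2 : conjq x + x - conjq x * realq N * x = 0.
  have -> : conjq x * realq N * x = realq (N * qnorm x).
    by apply: quatP; rewrite !quatE /qnorm; split=> /=; ring.
  by rewrite -xN; apply: quatP; rewrite !quatE; split=> /=; ring.
rewrite /Sp adj_quasirefl; split.
  exact: etrans (quasireflM x (conjq x) uu) (etrans (congr1 (quasirefl u) e1) q0).
exact: etrans (quasireflM (conjq x) x uu) (etrans (congr1 (quasirefl u) e2) q0).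
Qed.

End Symplectic.

(** * Square roots of unit quaternions and of quasi-reflections *)

Section SquareRoots.
Variable R : rcfType.

Lemma qnorm_sqrt (q : quat R) : qnorm q = 1 ->
  exists r, [/\ qnorm r = 1, q = r * r & qj q = 0 -> qk q = 0 -> qj r = 0 /\ qk r = 0].
Proof.
case: q => a b c d; rewrite /qnorm /= => q1.
(* Here [1 + a = 0] forces q = -1, for which i is a square root inside the circle. *)
have [a1|a1] := eqVneq (1 + a) 0.
  have aN : a = -1 by lra.
  subst a; have e : b ^+ 2 + c ^+ 2 + d ^+ 2 = 0 by lra.
  have sq0 (x : R) : x ^+ 2 <= 0 -> x = 0.
    by move=> x0; apply/eqP; rewrite -sqrf_eq0 -[_ == _]andbT eq_le x0 sqr_ge0.
  have b2 := sqr_ge0 b; have c2 := sqr_ge0 c; have d2 := sqr_ge0 d.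
  have -> : b = 0 by apply: sq0; lra.
  have -> : c = 0 by apply: sq0; lra.
  have -> : d = 0 by apply: sq0; lra.
  exists iq; split=> //; first by rewrite /qnorm /=; ring.
  by apply: quatP; rewrite !quatE; split=> /=; lra.
have a_gt : 0 < 2 * (1 + a).
  rewrite mulr_gt0 // lt_neqAle eq_sym a1 /=.
  have b2 := sqr_ge0 b; have c2 := sqr_ge0 c; have d2 := sqr_ge0 d.
  have : a ^+ 2 <= 1 by lra.
  by rewrite -ler_sqrt // sqrtr1 sqrtr_sqr ler_norml => /andP[]; lra.
(* For a unit quaternion q with real part [a], (1 + q)^2 = 2 (1 + a) q and |1 + q|^2 = 2 (1 + a), so
   the normalization of 1 + q is a square root. *)
set k := (Num.sqrt (2 * (1 + a)))^-1.
have kk : k ^+ 2 * (2 * (1 + a)) = 1.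
  by rewrite exprVn sqr_sqrtr ?ltW // mulVf // gt_eqF.
exists (realq k * Quat (1 + a) b c d); split.
- rewrite /qnorm quatME /=.
  transitivity (k ^+ 2 * (2 * (1 + a)) +
    k ^+ 2 * ((a ^+ 2 + b ^+ 2 + c ^+ 2 + d ^+ 2) - 1)).
    by ring.
  by rewrite q1 subrr mulr0 addr0.
- apply: quatP; rewrite !quatE /=; split.
  + transitivity (k ^+ 2 * (2 * (1 + a)) * a -
       k ^+ 2 * ((a ^+ 2 + b ^+ 2 + c ^+ 2 + d ^+ 2) - 1)); last by ring.
    by rewrite q1 subrr mulr0 subr0 kk mul1r.
  + by transitivity (k ^+ 2 * (2 * (1 + a)) * b); [rewrite kk mul1r|ring].
  + by transitivity (k ^+ 2 * (2 * (1 + a)) * c); [rewrite kk mul1r|ring].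
  by transitivity (k ^+ 2 * (2 * (1 + a)) * d); [rewrite kk mul1r|ring].
by rewrite quatME /= => -> ->; split; ring.
Qed.

(** A square root [r] of the unit quaternion [1 - realq N * x] is again of the form
    [1 - realq N * y], and [y] is the parameter of the root. *)
Lemma quasirefl_square n (u : 'cV[quat R]_n) N x : adjq u *m u = (realq N)%:M ->
  N != 0 -> qre x + qre x = N * qnorm x ->
  exists2 S, Sp S & quasirefl u x = S *m S.
Proof.
move=> uu N0 xN; pose q := 1 - realq N * x.
have [|r [r1 qr _]] := qnorm_sqrt (q := q).
  rewrite /q !quatE /qnorm /=; move: xN; rewrite /qnorm => xN.
  by transitivity (1 + N * (N * (qre x ^+ 2 + qi x ^+ 2 + qj x ^+ 2 + qk x ^+ 2) -
     (qre x + qre x))); [ring | rewrite -xN subrr mulr0 addr0].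
pose y := realq N^-1 * (1 - r).
have NN : N^-1 * N = 1 by rewrite mulVf.
have yE : qnorm y = N^-1 * (qre y + qre y).
  rewrite /y !quatE /qnorm /=; move: r1; rewrite /qnorm => r1.
  transitivity (N^-1 ^+ 2 * (2 * (1 - qre r) +
    ((qre r ^+ 2 + qi r ^+ 2 + qj r ^+ 2 + qk r ^+ 2) - 1))); first by ring.
  by rewrite r1 subrr; ring.
exists (quasirefl u y).
  by apply: (quasirefl_Sp uu); rewrite yE mulrA divff // mul1r.
rewrite (quasireflM _ _ uu); congr quasirefl.
have -> : y + y - y * realq N * y = realq N^-1 * (1 - r * r).
  have -> : y * realq N * y = realq N^-1 * ((1 - r) * (1 - r)).
    transitivity (realq (N^-1 * N) * (realq N^-1 * ((1 - r) * (1 - r)))).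
      by rewrite /y; apply: quatP; rewrite !quatE; split=> /=; ring.
    by rewrite NN; apply: quatP; rewrite !quatE; split=> /=; ring.
  by rewrite /y; apply: quatP; rewrite !quatE; split=> /=; ring.
rewrite -qr /q opprB addrC subrK.
transitivity (realq (N^-1 * N) * x); first rewrite NN;
  by apply: quatP; rewrite !quatE; split=> /=; ring.
Qed.

(* Induction on the number of fixed basis vectors: if A moves e_k, then the
   quasi-reflection along e_k - A e_k maps e_k to A e_k, and it fixes every
   basis vector fixed by A. *)
Lemma Sp_square_ind n (P : 'M[quat R]_n -> Prop) :
  (forall A B, Sp A -> Sp B -> P A -> P B -> P (A *m B)) ->
  (forall A, Sp A -> P (A *m A)) -> forall A, Sp A -> P A.
Proof.
move=> PM PS.
pose e (j : 'I_n) : 'cV[quat R]_n := delta_mx j 0.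
have adj_e (j : 'I_n) (w : 'cV[quat R]_n) i l : (adjq (e j) *m w) i l = w j 0.
  rewrite mxE (bigD1 j) //= big1 => [|k /negPf kj]; rewrite adjqE !mxE.
    by rewrite !ord1 !eqxx conjq1 mul1r addr0.
  by rewrite kj conjq0 mul0r.
have main k : (k <= n)%N -> forall A, Sp A ->
    (forall j : 'I_n, (j < n - k)%N -> A *m e j = e j) -> P A.
  elim: k => [_ A SA fixA|k IHk k_lt A SA fixA].
    suff -> : A = 1%:M *m 1%:M by apply: PS (Sp1 _ _).
    rewrite mulmx1; apply/matrixP => i j; transitivity ((A *m e j) i 0).
      rewrite mxE (bigD1 j) //= big1 => [|l lj]; first by rewrite mxE !eqxx mulr1 addr0.
      by rewrite mxE (negPf lj) mulr0.
    by rewrite fixA ?subn0 // !mxE eqxx andbT.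
  have k1_lt : (n - k.+1 < n)%N by lia.
  pose K := Ordinal k1_lt; pose v := e K; pose w := A *m v.
  have nk (j : 'I_n) : (j < n - k)%N -> j = K \/ (j < n - k.+1)%N.
    move=> jk; case: (ltngtP j (n - k.+1)%N) => [|jk'|jk']; [by right | lia |].
    by left; apply/val_inj.
  have [wv|wv] := eqVneq w v.
    by apply: (IHk (ltnW k_lt) _ SA) => j /nk[->//|]; exact: fixA.
  pose u := v - w; have [SA1 SA2] := SA.
  have ww : adjq w *m w = adjq v *m v by rewrite adjqM mulmxA -(mulmxA _ _ A) SA2 mulmx1.
  pose N : R := \sum_i qnorm (u i 0).
  have uu : adjq u *m u = (realq N)%:M.
    apply/matrixP => i j; rewrite !ord1 !mxE eqxx mulr1n realq_sum.
    by apply: eq_bigr => l _; rewrite adjqE mul_conjq.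
  have qnorm_ge0 (x : quat R) : 0 <= qnorm x.
    by rewrite /qnorm !addr_ge0 // sqr_ge0.
  have N0 : N != 0.
    apply: contra_neq wv => N0; apply/esym/eqP; rewrite -subr_eq0; apply/eqP.
    apply/matrixP => i j; rewrite ord1 [RHS]mxE -/u.
    have /eqP := N0; rewrite psumr_eq0 // => /allP/(_ i (mem_index_enum i))/eqP.
    case: (u i 0) => a b c d; rewrite /qnorm /= => s0.
    have sq0 (x : R) : x ^+ 2 <= 0 -> x = 0.
      by move=> x0; apply/eqP; rewrite -sqrf_eq0 -[_ == _]andbT eq_le x0 sqr_ge0.
    have a2 := sqr_ge0 a; have b2 := sqr_ge0 b; have c2 := sqr_ge0 c; have d2 := sqr_ge0 d.
    by apply: quatP; split=> /=; apply: sq0; lra.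
  pose al : quat R := (adjq u *m v) 0 0.
  have alv : adjq u *m v = al%:M.
    by apply/matrixP => i j; rewrite !ord1 [RHS]mxE mulr1n.
  (* Since [v] and [w = v - u] have the same norm, |u|^2 = 2 Re <u, v>. *)
  have alN : qre al + qre al = N.
    have e1 : al + conjq al = realq N.
      have -> : realq N = (adjq u *m u) 0 0 by rewrite uu mxE mulr1n.
      have -> : conjq al = (adjq v *m u) 0 0.
        by rewrite -(adjqK u) -adjqM adjqE.
      have vvww : adjq u *m v + adjq v *m u = adjq u *m u.
        have Z (V : zmodType) (b c d : V) : (b - c) + (b - d) = b - d - (c - b).
          by rewrite opprB addrC.
        by rewrite /u adjqD adjqN !(mulmxBl, mulmxBr) ww; apply: Z.
      by rewrite -vvww [RHS]mxE.
    have /(congr1 (@qre R)) := e1.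
    by rewrite !quatE.
  have al0 : qnorm al != 0.
    apply: contra N0; rewrite /qnorm => /eqP al0; rewrite -alN.
    have a2 := sqr_ge0 (qi al); have b2 := sqr_ge0 (qj al); have c2 := sqr_ge0 (qk al).
    have : qre al ^+ 2 <= 0 by lra.
    by rewrite -[_ <= _]andbT -(sqr_ge0 (qre al)) -eq_le sqrf_eq0 => /eqP ->; rewrite addr0.
  (* The inverse of [al = <u, v>], so that the quasi-reflection sends [v] to [v - u = w]; the
     identity [alN] is then what places it in Sp(n). *)
  pose x := realq (qnorm al)^-1 * conjq al.
  have xal : x * al = 1.
    rewrite /x -mulrA mul_conjq; apply: quatP; rewrite !quatE /=.
    by split; rewrite ?mulVf //; ring.
  have xN : qre x + qre x = N * qnorm x.
    have -> : qnorm x = (qnorm al)^-1.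
      rewrite /x; have := mulVf al0; move: (qnorm al)^-1 => c cc.
      transitivity (c * (c * qnorm al)); last by rewrite cc mulr1.
      by rewrite /qnorm quatME /=; ring.
    by rewrite -alN /x quatME /=; ring.
  pose Q := quasirefl u x.
  have Qv : Q *m v = w.
    rewrite /Q /quasirefl mulmxBl mul1mx -!mulmxA alv -scalar_mxM xal mulmx1.
    by rewrite /u opprB addrC subrK.
  have SQ : Sp Q by apply: quasirefl_Sp uu xN.
  have [S SS QS] := quasirefl_square uu N0 xN.
  have -> : A = Q *m (adjq Q *m A) by rewrite mulmxA SQ.1 mul1mx.
  have SQA : Sp (adjq Q *m A) by apply: SpM SA; apply: Sp_adj.
  apply: (PM _ _ SQ SQA); first by rewrite /Q QS; apply: PS.
  apply: (IHk (ltnW k_lt) _ SQA) => j /nk[->|jk].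
    by rewrite -mulmxA -/v -/w -Qv mulmxA SQ.2 mul1mx.
  rewrite -mulmxA fixA // /Q adj_quasirefl /quasirefl mulmxBl mul1mx.
  suff -> : u *m (conjq x)%:M *m adjq u *m e j = 0 by rewrite subr0.
  rewrite -mulmxA; suff -> : adjq u *m e j = 0 by rewrite mulmx0.
  (* As [A] preserves the inner product and fixes [e j], the vectors [v] and [w = A v] have the same
     product with [e j], so [u] is orthogonal to it. *)
  rewrite /u adjqD adjqN mulmxBl.
  have -> : adjq w *m e j = adjq v *m e j.
    by rewrite -{1}(fixA j jk) adjqM mulmxA -(mulmxA _ _ A) SA2 mulmx1.
  by rewrite subrr.
by move=> A SA; apply: (main n (leqnn n) A SA) => j; rewrite subnn.
Qed.

End SquareRoots.

(** * The action on omega *)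

Section Anticommuting.
Variables (K : comNzRingType) (V : algType K) (n : nat) (e o : 'I_n -> V).
Hypothesis two_inj : injective (fun v : V => v + v).
Hypothesis ee : forall j l, e j * e l = - (e l * e j).
Hypothesis oo : forall j l, o j * o l = - (o l * o j).
Hypothesis oe : forall j l, o j * e l = - (e l * o j).

Lemma sum_sym_anti (f : 'I_n -> V) (M : 'I_n -> 'I_n -> K) :
  (forall j l, f j * f l = - (f l * f j)) -> (forall j l, M j l = M l j) ->
  \sum_j \sum_l M j l *: (f j * f l) = 0.
Proof.
move=> anti sym; apply: two_inj; rewrite addr0 {1}exchange_big -big_split big1 //= => j _.
by rewrite -big_split big1 //= => l _; rewrite sym anti scalerN addNr.
Qed.

(** The hypotheses say that the matrix with rows of blocks [a], [c] and [b], [d] is symplectic, [a]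
    and [b] giving the images of the [e k]. The products [e e] and [o o] drop out because symmetric
    coefficients meet anticommuting factors. *)
Lemma sum_symplectic (a b c d : 'I_n -> 'I_n -> K) :
  (forall j l, \sum_k a j k * c l k = \sum_k a l k * c j k) ->
  (forall j l, \sum_k b j k * d l k = \sum_k b l k * d j k) ->
  (forall j l, \sum_k (a j k * d l k - b l k * c j k) = (j == l)%:R) ->
  \sum_k (\sum_j (a j k *: e j + b j k *: o j)) * (\sum_l (c l k *: e l + d l k *: o l)) =
  \sum_k e k * o k.
Proof.
move=> ac bd abcd.
transitivity (\sum_j \sum_l (\sum_k a j k * c l k) *: (e j * e l) +
  \sum_j \sum_l (\sum_k b j k * d l k) *: (o j * o l) +
  (\sum_j \sum_l (\sum_k a j k * d l k) *: (e j * o l) -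
   \sum_j \sum_l (\sum_k b j k * c l k) *: (e l * o j))).
  rewrite -sumrB -!big_split /=.
  under eq_bigr => k _ do rewrite mulr_suml.
  rewrite exchange_big; apply: eq_bigr => j _.
  under eq_bigr => k _ do rewrite mulr_sumr.
  rewrite exchange_big -sumrB -!big_split; apply: eq_bigr => l _ /=.
  rewrite !scaler_suml -sumrB -!big_split; apply: eq_bigr => k _ /=.
  rewrite mulrDl !mulrDr -!scalerAl -!scalerAr !scalerA oe scalerN.
  by rewrite [- _ + _]addrC addrACA.
rewrite (sum_sym_anti ee ac) (sum_sym_anti oo bd) !add0r.
rewrite [X in _ - X]exchange_big -sumrB; apply: eq_bigr => j _.
rewrite -sumrB (bigD1 j) //= [X in _ + X]big1 => [|l lj].
  by rewrite -scalerBl -sumrB abcd eqxx scale1r addr0.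
by rewrite -scalerBl -sumrB abcd eq_sym (negPf lj) scale0r.
Qed.

End Anticommuting.

(** * The complex matrix of an isotropy element on pairs of generators *)

Section Pairs.
Variables (R : realType) (n : nat).
Local Notation C := R[i]%C.
Local Notation I := 'I_(2 * n).+1.
Local Notation M := 'M[quat R]_(1 + n).

(** The positions of y_(2p) and y_(2p+1) for p = k + 1. The names follow the subscripts of y, which
    exceed the positions by 1. *)
Definition yev (k : 'I_n) : I := inord k.*2.+1.
Definition yod (k : 'I_n) : I := inord k.*2.+2.

Lemma yevE k : yev k = k.*2.+1 :> nat.
Proof. by rewrite inordK //; have := ltn_ord k; lia. Qed.

Lemma yodE k : yod k = k.*2.+2 :> nat.
Proof. by rewrite inordK //; have := ltn_ord k; lia. Qed.

Variant ord_pair_spec : I -> Prop :=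
  | OrdPair0 : ord_pair_spec ord0
  | OrdPairEv k : ord_pair_spec (yev k)
  | OrdPairOd k : ord_pair_spec (yod k).

Lemma ord_pairP (q : I) : ord_pair_spec q.
Proof.
have [q0|q_gt0] := posnP q; first by rewrite (_ : q = ord0); [constructor | apply/val_inj].
have k_lt : ((q.-1)./2 < n)%N by have := ltn_ord q; lia.
case: (boolP (odd q)) => oq.
  rewrite (_ : q = yev (Ordinal k_lt)); first by constructor.
  by apply/val_inj; rewrite /= yevE /=; lia.
rewrite (_ : q = yod (Ordinal k_lt)); first by constructor.
by apply/val_inj; rewrite /= yodE /=; lia.
Qed.

Lemma sum_ord_pair (V : nmodType) (F : I -> V) :
  \sum_q F q = F ord0 + \sum_k (F (yev k) + F (yod k)).
Proof.
rewrite big_ord_recl; congr (_ + _).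
have pairs (G : nat -> V) m : \sum_(i < 2 * m) G i = \sum_(q < m) (G q.*2 + G q.*2.+1).
  rewrite mul2n; elim: m => [|m IHm]; first by rewrite !big_ord0.
  by rewrite doubleS !big_ord_recr /= IHm addrA.
rewrite (eq_bigr (fun i : 'I_(2 * n) => F (inord i.+1))) => [|i _].
  exact: (pairs (fun i => F (inord i.+1))).
by congr F; apply/val_inj; rewrite /= inordK // ltnS.
Qed.

Definition hmx (z : quat R) (A : 'M[quat R]_n) : M := block_mx z%:M 0 0 A.

Lemma hmxM z A z' A' : hmx z A *m hmx z' A' = hmx (z * z') (A *m A').
Proof. by rewrite /hmx mulmx_block !mulmx0 !mul0mx !addr0 add0r scalar_mxM. Qed.

Lemma hmx_U1Sp z A : U1 z -> Sp A -> U1Sp (hmx z A).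
Proof. by move=> Uz SA; exists z, A. Qed.

Lemma U1_1 : U1 (1 : quat R).
Proof. by split=> //=; ring. Qed.

Lemma U1_conj (z : quat R) : U1 z -> U1 (conjq z) /\ conjq z * z = 1.
Proof.
case: z => a b c d [/= -> -> n1]; split; first by split=> /=; rewrite ?oppr0 // sqrrN.
by apply: quatP; rewrite !quatE /=; split; try ring; rewrite -n1; ring.
Qed.

Lemma hmx1 : hmx 1 1%:M = 1%:M.
Proof. by rewrite /hmx -scalar_mx_block. Qed.

Lemma hmx00 z A : hmx z A ord0 ord0 = z.
Proof.
have -> : ord0 = lshift n (ord0 : 'I_1) by apply/val_inj.
by rewrite block_mxEul mxE eqxx.
Qed.

Lemma hmx0r z A k : hmx z A ord0 (rshift 1 k) = 0.
Proof.
have -> : ord0 = lshift n (ord0 : 'I_1) by apply/val_inj.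
by rewrite block_mxEur mxE.
Qed.

Lemma hmxr0 z A k : hmx z A (rshift 1 k) ord0 = 0.
Proof.
have -> : ord0 = lshift n (ord0 : 'I_1) by apply/val_inj.
by rewrite block_mxEdl mxE.
Qed.

Lemma qcol0 : qcol n 0 = ord0.
Proof. by apply/val_inj; rewrite /= inordK. Qed.

Lemma qcol_yev k : qcol n (yev k) = rshift 1 k.
Proof.
apply/val_inj; rewrite /= yevE inordK; have := ltn_ord k; last by lia.
by rewrite /=; lia.
Qed.

Lemma qcol_yod k : qcol n (yod k) = rshift 1 k.
Proof.
apply/val_inj; rewrite /= yodE inordK; have := ltn_ord k; last by lia.
by rewrite /=; lia.
Qed.

Lemma qunit_yev k : qunit R (yev k) = jq.
Proof. by rewrite /qunit yevE /= odd_double. Qed.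

Lemma qunit_yod k : qunit R (yod k) = iq.
Proof. by rewrite /qunit yodE /= odd_double. Qed.

(** On the circle this is conj(z), the factor by which [z] acts on the horizontal generators. *)
Definition qcirc (z : quat R) : C := Complex (qre z) (- qi z).

Lemma qcircM z z' : U1 z -> U1 z' -> qcirc (z * z') = qcirc z * qcirc z'.
Proof.
case: z z' => a b c d [a' b' c' d'] [/= -> -> _] [/= -> -> _].
by apply/eqP; rewrite eq_complex quatME /=; apply/andP; split; apply/eqP; ring.
Qed.

Section Uentry.
Variables (z : quat R) (A : 'M[quat R]_n) (Uz : U1 z).

Lemma uentry00 : uentry (hmx z A) 0 0 = qcirc z ^+ 2.
Proof.
rewrite /uentry qcol0 hmx00 /qunit /=; case: z Uz => a b c d [/= -> -> _].
apply/eqP; rewrite eq_complex expr2 /=.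
by apply/andP; split; apply/eqP; ring.
Qed.

Lemma uentry0r k : uentry (hmx z A) 0 (yev k) = 0 /\ uentry (hmx z A) 0 (yod k) = 0.
Proof.
by rewrite /uentry qcol0 qcol_yev qcol_yod hmx0r conjq0 !mulr0 !mul0r /= oppr0.
Qed.

Lemma uentryr0 k : uentry (hmx z A) (yev k) 0 = 0 /\ uentry (hmx z A) (yod k) 0 = 0.
Proof.
by rewrite /uentry qcol0 qcol_yev qcol_yod hmxr0 conjq0 !mulr0 !mul0r /= oppr0.
Qed.

(** Up to the factor [qcirc z], this is a standard embedding of the quaternions into the complex 2 x
    2 matrices. *)
Lemma uentry_pair j k (x := A j k) :
  [/\ uentry (hmx z A) (yev j) (yev k) = qcirc z * Complex (qre x) (- qi x),
      uentry (hmx z A) (yod j) (yev k) = qcirc z * Complex (- qk x) (qj x),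
      uentry (hmx z A) (yev j) (yod k) = qcirc z * Complex (qk x) (qj x) &
      uentry (hmx z A) (yod j) (yod k) = qcirc z * Complex (qre x) (qi x)].
Proof.
rewrite /uentry !qcol_yev !qcol_yod !qunit_yev !qunit_yod hmx00.
have -> : hmx z A (rshift 1 j) (rshift 1 k) = x by rewrite block_mxEdr.
clearbody x; case: z Uz x => a b c d [/= -> -> _] [x1 x2 x3 x4].
by split; apply/eqP; rewrite eq_complex /=; apply/andP; split; apply/eqP; ring.
Qed.

End Uentry.

End Pairs.

Section SpinorAlgebra.
Variables (R : realType) (n : nat).
Local Notation C := R[i]%C.
Local Notation I := 'I_(2 * n).+1.
Implicit Types (eta : spinor R n).

Lemma gen_anti (p q : I) : gen R p * gen R q = - (gen R q * gen R p).
Proof.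
rewrite /gen !cliff_gen_mul_base !cliff_coef1 symdiffC -scaleNr; congr (_ *: _).
rewrite /koszul !big_set1 !inE; have [->|pq] := eqVneq p q; first by rewrite !mulr0 oppr0.
have : p != q :> nat by rewrite (inj_eq val_inj).
by case: ltngtP => // _ _; rewrite !mulr1 ?opprK.
Qed.

Lemma spinor_double_inj : injective (fun eta => eta + eta).
Proof.
move=> eta1 eta2 /= eq12; have two : 2%:R != 0 :> C by rewrite pnatr_eq0.
by apply: (scalerI two); rewrite !scaler_nat !mulr2n.
Qed.

Lemma scoef1 B : scoef (1 : spinor R n) B = (B == set0)%:R.
Proof. by rewrite cliff_oneE scoef_base. Qed.

Lemma ctr1 (q : I) : ctr q (1 : spinor R n) = 0.
Proof.
apply/scoefP => B; rewrite scoef_ctr scoef0; case: ifP => // qB.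
rewrite scoef1; case: eqP => [/setP/(_ q)|_]; last by rewrite mulr0.
by rewrite in_symdiff1 eqxx qB inE.
Qed.

(** A nonempty monomial survives contraction by any of its own generators. *)
Lemma ctr_eq0 eta : (forall q, ctr q eta = 0) -> eta = scoef eta set0 *: 1.
Proof.
move=> ctr0; apply/scoefP => B; rewrite scoefZ scoef1.
have [->|[q qB]] := set_0Vmem B; first by rewrite eqxx mulr1.
have -> : (B == set0) = false by apply/eqP => B0; rewrite B0 inE in qB.
have := congr1 (fun x => scoef x (symdiff [set q] B)) (ctr0 q).
rewrite scoef_ctr scoef0 in_symdiff1 eqxx qB /= symdiffK mulr0.
move/eqP; rewrite mulf_eq0 => /orP[/eqP k0|/eqP ->//].
by have := koszul_sqr C q (symdiff [set q] B); rewrite k0 mulr0 => /eqP;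
  rewrite eq_sym oner_eq0.
Qed.

Lemma omegaE : omega R n = \sum_k gen R (yev k) * gen R (yod k).
Proof.
rewrite /omega big_add1 big_mkord; apply: eq_bigr => k _.
by rewrite /y_ /gen; congr (cliff_gen _ (inord _) * cliff_gen _ (inord _));
  rewrite -mul2n mulnS.
Qed.

Lemma y1E : y_ R n 1 = gen R ord0.
Proof. by rewrite /y_ -/(gen R _); congr gen; apply/val_inj; rewrite /= inordK. Qed.

Lemma cliff_base_gen (B : {set I}) :
  cliff_base 0 B = \prod_(q <- enum B) gen R q :> spinor R n.
Proof. exact: cliff_base_prod. Qed.

End SpinorAlgebra.

(** * Action of the lifts on the vacuum and on powers of omega *)

Section Lift.
Variables (R : realType) (n : nat) (a t : R) (a_gt0 : 0 < a) (t_gt0 : 0 < t).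
Local Notation C := R[i]%C.
Local Notation I := 'I_(2 * n).+1.
Local Notation M := 'M[quat R]_(1 + n).
Variable s : M -> cliff (-1 : R) (4 * n).+2.
Hypothesis s_lift : isotropy_lift a t s.
Implicit Types (h : M) (eta : spinor R n) (z : quat R) (A : 'M[quat R]_n).

Local Notation T h := (srep (s h)).

Lemma lift_spin h : U1Sp h -> spin_group (s h).
Proof. by case: s_lift => sp _ _ _; exact: sp. Qed.

Lemma liftM g h eta : U1Sp g -> U1Sp h -> T (g *m h) eta = T g (T h eta).
Proof. by case: s_lift => _ sM _ _ Ug Uh; rewrite sM // srepM. Qed.

Lemma U1Sp_1 : U1Sp (1%:M : M).
Proof. by rewrite -(hmx1 R n); apply: hmx_U1Sp (U1_1 R) (Sp1 _ _). Qed.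

Lemma lift1 eta : T 1%:M eta = eta.
Proof.
have U1 := U1Sp_1; apply: (srep_idem _ (lift_spin U1)).
by case: s_lift => _ sM _ _; rewrite -sM // mulmx1.
Qed.

Definition vac h : C := scoef (T h 1) set0.

(** The lift of the inverse turns a contraction of [T h 1] into a combination of contractions of 1,
    which vanish. By injectivity every contraction of [T h 1] vanishes. *)
Lemma lift_vac z A : U1 z -> Sp A -> T (hmx z A) 1 = vac (hmx z A) *: 1.
Proof.
move=> Uz SA; set h := hmx z A; have Uh : U1Sp h by apply: hmx_U1Sp.
pose h' := hmx (conjq z) (adjq A).
have [Uz' zz] := U1_conj Uz.
have Uh' : U1Sp h' by apply: hmx_U1Sp Uz' (Sp_adj SA).
have hh : h' *m h = 1%:M by rewrite /h' /h hmxM zz SA.2 hmx1.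
apply: ctr_eq0 => q; apply: (srep_inj (lift_spin Uh')).
rewrite (lift_ctr a_gt0 t_gt0 s_lift) // -liftM // hh lift1 big1 // => p _.
by rewrite ctr1 scaler0.
Qed.

Lemma lift_prod z A (r : seq I) : U1 z -> Sp A ->
  T (hmx z A) (\prod_(q <- r) gen R q) =
  vac (hmx z A) *: \prod_(q <- r) lift_y (hmx z A) q.
Proof.
move=> Uz SA; have Uh := hmx_U1Sp Uz SA; elim: r => [|q r IHr].
  by rewrite !big_nil lift_vac.
by rewrite !big_cons (lift_gen a_gt0 t_gt0 s_lift) // IHr -scalerAr.
Qed.

Lemma lift_y0 z A : U1 z -> lift_y (hmx z A) 0 = qcirc z ^+ 2 *: gen R ord0.
Proof.
move=> Uz; rewrite /lift_y sum_ord_pair /= uentry00 // big1 ?addr0 // => k _.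
by have [-> ->] := uentryr0 z A k; rewrite !scale0r addr0.
Qed.

Lemma lift_yev z A k : U1 z -> lift_y (hmx z A) (yev k) = qcirc z *: \sum_j
  ((Complex (qre (A j k)) (- qi (A j k)) : C) *: gen R (yev j) +
   (Complex (- qk (A j k)) (qj (A j k)) : C) *: gen R (yod j)).
Proof.
move=> Uz; rewrite /lift_y sum_ord_pair; have [-> _] := uentry0r z A k.
rewrite scale0r add0r scaler_sumr; apply: eq_bigr => j _.
by have [-> -> _ _] := uentry_pair A Uz j k; rewrite scalerDr !scalerA.
Qed.

Lemma lift_yod z A k : U1 z -> lift_y (hmx z A) (yod k) = qcirc z *: \sum_j
  ((Complex (qk (A j k)) (qj (A j k)) : C) *: gen R (yev j) +
   (Complex (qre (A j k)) (qi (A j k)) : C) *: gen R (yod j)).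
Proof.
move=> Uz; rewrite /lift_y sum_ord_pair; have [_ ->] := uentry0r z A k.
rewrite scale0r add0r scaler_sumr; apply: eq_bigr => j _.
by have [_ _ -> ->] := uentry_pair A Uz j k; rewrite scalerDr !scalerA.
Qed.

Lemma sum_Complex (J : Type) (r : seq J) (F G : J -> R) :
  \sum_(k <- r) (Complex (F k) (G k) : C) =
  Complex (\sum_(k <- r) F k) (\sum_(k <- r) G k).
Proof.
elim: r => [|j r IHr]; first by rewrite !big_nil.
by rewrite !big_cons IHr; apply/eqP; rewrite eq_complex /= !eqxx.
Qed.

(** The complex matrix of an element of Sp(n) is symplectic, hence preserves omega, and each of the
    two factors contributes one [qcirc z]. The symplectic relations are read off from the components
    of [A *m adjq A = 1%:M]. *)
Lemma lift_omega_pairs z A : U1 z -> Sp A ->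
  \sum_(k < n) lift_y (hmx z A) (yev k) * lift_y (hmx z A) (yod k) =
  qcirc z ^+ 2 *: omega R n.
Proof.
move=> Uz [SA _].
under eq_bigr => k _ do rewrite lift_yev // lift_yod // -scalerAl -scalerAr scalerA -expr2.
rewrite -scaler_sumr omegaE; congr (_ *: _).
have AA j l : \sum_k A j k * conjq (A l k) = (1%:M : 'M[quat R]_n) j l.
  by rewrite -SA mxE; apply: eq_bigr => k _; rewrite adjqE.
have comp (f : quat R -> R) : (forall x y, f (x + y) = f x + f y) -> f 0 = 0 -> forall j l,
    \sum_k f (A j k * conjq (A l k)) = f ((1%:M : 'M[quat R]_n) j l).
  by move=> fD f0 j l; rewrite -AA (big_morph f fD f0).
have Cj : forall j l, \sum_k qj (A j k * conjq (A l k)) = 0.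
  by move=> j l; rewrite (comp (@qj R)) // mxE; case: (_ == _).
have Ck : forall j l, \sum_k qk (A j k * conjq (A l k)) = 0.
  by move=> j l; rewrite (comp (@qk R)) // mxE; case: (_ == _).
have Ci : forall j l, \sum_k qi (A j k * conjq (A l k)) = 0.
  by move=> j l; rewrite (comp (@qi R)) // mxE; case: (_ == _).
have Cr : forall j l, \sum_k qre (A j k * conjq (A l k)) = (j == l)%:R.
  by move=> j l; rewrite (comp (@qre R)) // mxE; case: (_ == _).
apply: (sum_symplectic (@spinor_double_inj R n)
  (fun j l => gen_anti R (yev j) (yev l)) (fun j l => gen_anti R (yod j) (yod l))
  (fun j l => gen_anti R (yod j) (yev l))
  (a := fun j k => Complex (qre (A j k)) (- qi (A j k)))
  (b := fun j k => Complex (- qk (A j k)) (qj (A j k)))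
  (c := fun j k => Complex (qk (A j k)) (qj (A j k)))
  (d := fun j k => Complex (qre (A j k)) (qi (A j k)))) => j l.
- apply/eqP; rewrite -subr_eq0 -sumrB; apply/eqP.
  transitivity (\sum_k (Complex (- qk (A j k * conjq (A l k)))
    (- qj (A j k * conjq (A l k))) : C)).
    apply: eq_bigr => k _; move: (A j k) (A l k) => [w x y u] [w' x' y' u'].
    by apply/eqP; rewrite eq_complex /=; apply/andP; split; apply/eqP; ring.
  by rewrite sum_Complex !sumrN Cj Ck oppr0.
- apply/eqP; rewrite -subr_eq0 -sumrB; apply/eqP.
  transitivity (\sum_k (Complex (- qk (A j k * conjq (A l k)))
    (qj (A j k * conjq (A l k))) : C)).
    apply: eq_bigr => k _; move: (A j k) (A l k) => [w x y u] [w' x' y' u'].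
    by apply/eqP; rewrite eq_complex /=; apply/andP; split; apply/eqP; ring.
  by rewrite sum_Complex !sumrN Cj Ck oppr0.
transitivity (\sum_k (Complex (qre (A j k * conjq (A l k)))
  (- qi (A j k * conjq (A l k))) : C)).
  apply: eq_bigr => k _; move: (A j k) (A l k) => [w x y u] [w' x' y' u'].
  by apply/eqP; rewrite eq_complex /=; apply/andP; split; apply/eqP; ring.
by rewrite sum_Complex sumrN Cr Ci oppr0; case: (_ == _).
Qed.

Lemma lift_omega z A eta : U1 z -> Sp A ->
  T (hmx z A) (omega R n * eta) = qcirc z ^+ 2 *: (omega R n * T (hmx z A) eta).
Proof.
move=> Uz SA; rewrite {1}omegaE mulr_suml srep_sumr scalerAl -(lift_omega_pairs Uz SA).
rewrite mulr_suml; apply: eq_bigr => k _; have Uh := hmx_U1Sp Uz SA.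
by rewrite -!mulrA !(lift_gen a_gt0 t_gt0 s_lift).
Qed.

Lemma lift_omegaX z A k : U1 z -> Sp A ->
  T (hmx z A) (omega R n ^+ k) = (vac (hmx z A) * qcirc z ^+ (2 * k)) *: omega R n ^+ k.
Proof.
move=> Uz SA; elim: k => [|k IHk]; first by rewrite muln0 !expr0 mulr1 lift_vac.
rewrite ![omega R n ^+ k.+1]exprS lift_omega // IHk -scalerAr scalerA; congr (_ *: _).
by rewrite mulnS exprD; ring.
Qed.

Lemma lift_y1_omegaX z A k : U1 z -> Sp A ->
  T (hmx z A) (y_ R n 1 * omega R n ^+ k) =
  (vac (hmx z A) * qcirc z ^+ (2 * k.+1)) *: (y_ R n 1 * omega R n ^+ k).
Proof.
move=> Uz SA; have Uh := hmx_U1Sp Uz SA.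
rewrite y1E (lift_gen a_gt0 t_gt0 s_lift) // lift_y0 // lift_omegaX //.
rewrite -scalerAl -scalerAr scalerA; congr (_ *: _).
by rewrite mulnS exprD; ring.
Qed.

End Lift.

(** * Invariant spinors *)

(** Sets of equal size are joined by exchanges of single elements, each of which shrinks the
    difference [S :\: S']. *)
Lemma card_exchange_invariant (T : finType) (U : Type) (g : {set T} -> U) :
  (forall (S : {set T}) p p', p \in S -> p' \notin S -> g S = g (p' |: S :\ p)) ->
  forall S S' : {set T}, #|S| = #|S'| -> g S = g S'.
Proof.
move=> gE S S'; move: {2}#|_| (leqnn #|S :\: S'|) => m.
elim: m S => [|m IHm] S le_m eqSS'.
  move: le_m; rewrite leqn0 cards_eq0 setD_eq0 => sSS'.
  by congr g; apply/eqP; rewrite eqEcard sSS' eqSS' leqnn.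
have [/eqP|[p pD]] := set_0Vmem (S :\: S').
  by rewrite setD_eq0 => sSS'; congr g; apply/eqP; rewrite eqEcard sSS' eqSS' leqnn.
have [/eqP|[p' p'D]] := set_0Vmem (S' :\: S).
  rewrite setD_eq0 => sS'S; congr g; apply/eqP; rewrite eq_sym eqEcard sS'S.
  by rewrite eqSS' leqnn.
move: pD p'D; rewrite !inE => /andP[pS' pS] /andP[p'S p'S'].
rewrite (gE S p p') //; apply: IHm; last first.
  by rewrite cardsU1 !inE (negPf p'S) andbF add1n -eqSS' (cardsD1 p S) pS.
rewrite -ltnS (leq_trans _ le_m) // proper_card //; apply/properP; split.
  apply/subsetP => x; rewrite !inE => /andP[xS']; case: eqP => [xp'|_ /=].
    by rewrite xp' p'S' in xS'.
  by case/andP=> _ ->; rewrite xS'.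
exists p; first by rewrite !inE pS'.
rewrite !inE eqxx /= orbF; apply/negP => /andP[_ /eqP pp'].
by rewrite -pp' pS in p'S.
Qed.

(** * Coefficients of monomials made of whole pairs *)

Section PairSets.
Variables (R : realType) (n : nat).
Local Notation C := R[i]%C.
Local Notation I := 'I_(2 * n).+1.
Implicit Types (eta : spinor R n) (b : bool) (S : {set 'I_n}) (k : 'I_n).

Definition yset b S : {set I} :=
  [set q : I | (b && (q == ord0)) || [exists k in S, (q == yev k) || (q == yod k)]].

Lemma yev_inj k l : (yev k == yev l) = (k == l).
Proof. by rewrite -(inj_eq val_inj) /= !yevE eqSS (inj_eq double_inj). Qed.

Lemma yod_inj k l : (yod k == yod l) = (k == l).
Proof. by rewrite -(inj_eq val_inj) /= !yodE !eqSS (inj_eq double_inj). Qed.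

Lemma yev_yod k l : (yev k == yod l) = false.
Proof.
rewrite -(inj_eq val_inj) /= yevE yodE; apply/eqP => /(congr1 odd).
by rewrite /= !odd_double.
Qed.

Lemma yod_yev k l : (yod k == yev l) = false.
Proof. by rewrite eq_sym yev_yod. Qed.

Lemma yev0 k : (yev k == ord0) = false.
Proof. by rewrite -(inj_eq val_inj) /= yevE. Qed.

Lemma yod0 k : (yod k == ord0) = false.
Proof. by rewrite -(inj_eq val_inj) /= yodE. Qed.

Definition yE := (yev_inj, yod_inj, yev_yod, yod_yev, yev0, yod0).

Lemma in_yset0 b S : (ord0 \in yset b S) = b.
Proof.
rewrite inE eqxx andbT; case: b => //=; apply/existsP => -[k].
by rewrite ![ord0 == _]eq_sym yev0 yod0 andbF.
Qed.

Lemma in_yset_ev b S k : (yev k \in yset b S) = (k \in S).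
Proof.
rewrite inE yev0 andbF /=; apply/existsP/idP => [[l]|kS].
  by rewrite yev_inj yev_yod orbF => /andP[lS /eqP ->].
by exists k; rewrite kS eqxx.
Qed.

Lemma in_yset_od b S k : (yod k \in yset b S) = (k \in S).
Proof.
rewrite inE yod0 andbF /=; apply/existsP/idP => [[l]|kS].
  by rewrite yod_inj yod_yev => /andP[lS /eqP ->].
by exists k; rewrite kS eqxx orbT.
Qed.

Definition in_yset := (in_yset0, in_yset_ev, in_yset_od).

Lemma setC_yset b S : ~: yset b S = yset (~~ b) (~: S).
Proof. by apply/setP => q; case: (ord_pairP q) => [|k|k]; rewrite in_setC !in_yset ?inE. Qed.

Lemma ysetT : yset true setT = setT.
Proof. by apply/setP => q; case: (ord_pairP q) => [|k|k]; rewrite !in_yset ?inE. Qed.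

Lemma card_yset b S : #|yset b S| = (b + 2 * #|S|)%N.
Proof.
rewrite -sum1_card big_mkcond /= (sum_ord_pair (fun q => if q \in yset b S then 1 else 0)%N).
rewrite in_yset0; congr (_ + _)%N.
rewrite -sum1_card big_distrr [RHS]big_mkcond; apply: eq_bigr => k _ /=.
by rewrite in_yset_ev in_yset_od; case: (k \in S).
Qed.

Lemma symdiff_pair b S k : symdiff [set yod k] (symdiff [set yev k] (yset b S)) =
  yset b (symdiff [set k] S).
Proof.
apply/setP => q; rewrite !in_symdiff1.
case: (ord_pairP q) => [|l|l]; rewrite !in_yset ?in_symdiff1 ?yE //.
  by rewrite ![ord0 == _]eq_sym !yE.
Qed.

(** The generator [yev k] is the only one below [yod k] that is not below [yev k]. *)
Lemma koszul_yod k B :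
  koszul C (yod k) B = koszul C (yev k) B * (if yev k \in B then -1 else 1).
Proof.
rewrite /koszul big_mkcond [in RHS]big_mkcond (bigD1 (yev k)) //= [in RHS](bigD1 (yev k)) //=.
rewrite ltnn yevE yodE ltnSn /= if_same mul1r mulrC; congr (_ * _).
apply: eq_bigr => j; rewrite -(inj_eq val_inj) /= yevE => jk.
by rewrite [in LHS]ltnS leq_eqVlt (negPf jk).
Qed.

Lemma koszul0 (B : {set I}) : koszul C (ord0 : I) B = 1.
Proof. by rewrite /koszul big1. Qed.

Lemma scoef_pair k eta b S : scoef (gen R (yev k) * (gen R (yod k) * eta)) (yset b S) =
  if k \in S then scoef eta (yset b (S :\ k)) else 0.
Proof.
rewrite !scoef_gen in_yset_ev in_symdiff1 yod_yev in_yset_od /=.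
case: ifP => // kS; rewrite kS symdiff_pair koszul_flip koszul_yod in_yset_ev kS.
have -> : (yev k < yod k)%N by rewrite yevE yodE ltnSn.
set x := scoef eta _.
have := koszul_sqr C (yev k) (yset b S); move: (koszul _ _ _) => c cc.
transitivity (c * c * x); [by ring | rewrite cc mul1r {}/x].
congr (scoef eta (yset b _)); apply/setP => l; rewrite in_symdiff1 !inE.
by case: eqP => [->|]; rewrite ?kS.
Qed.

(** A set of [m] pairs arises once for each of its [m!] orderings, always with sign +1 by
    [scoef_pair]. *)
Lemma scoef_omegaX (m : nat) b S :
  scoef (omega R n ^+ m) (yset b S) = if ~~ b && (#|S| == m) then (m`!)%:R else 0.
Proof.
elim: m S => [|m IHm] S.
  rewrite expr0 scoef1 -cards_eq0 card_yset.
  by case: b; case: #|S|.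
rewrite exprS omegaE mulr_suml scoef_sum.
under eq_bigr => l _ do rewrite -omegaE -mulrA scoef_pair IHm.
rewrite -big_mkcond /=.
under eq_bigr => l lS.
  rewrite (_ : (#|S :\ l| == m) = (#|S| == m.+1)); last by rewrite (cardsD1 l S) lS.
  over.
rewrite sumr_const; case: (b) => /=; first by rewrite mul0rn.
by case: eqP => [->|_]; rewrite ?mul0rn // factS natrM mulr_natl.
Qed.

Lemma scoef_y1 eta b S :
  scoef (y_ R n 1 * eta) (yset b S) = if b then scoef eta (yset false S) else 0.
Proof.
rewrite y1E scoef_gen in_yset0; case: b => //; rewrite koszul0 mul1r.
congr (scoef eta _); apply/setP => q; rewrite in_symdiff1.
by case: (ord_pairP q) => [|l|l]; rewrite !in_yset ?eqxx ?yE.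
Qed.

Lemma base_pair b S k : k \notin S ->
  gen R (yev k) * (gen R (yod k) * cliff_base 0 (yset b S)) =
  cliff_base 0 (yset b (k |: S)) :> spinor R n.
Proof.
move=> kS; rewrite /gen cliff_gen_mul_base -scalerAr cliff_gen_mul_base scalerA.
rewrite !cliff_coef1 in_symdiff1 yev_yod in_yset_od in_yset_ev (negPf kS) /= !mulr1.
rewrite koszul_flip koszul_yod in_yset_ev (negPf kS) mulr1.
have -> : (yod k < yev k)%N = false by rewrite yodE yevE ltnNge leqnSn.
rewrite mulr1 koszul_sqr scale1r; congr (cliff_base 0 _).
rewrite symdiffA [symdiff [set yev k] _]symdiffC -symdiffA symdiff_pair.
congr (yset b _); apply/setP => l; rewrite in_symdiff1 !inE.
by case: eqP => [->|]; rewrite ?(negPf kS).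
Qed.

Lemma yset_closed (B : {set I}) : (forall k, (yev k \in B) = (yod k \in B)) ->
  B = yset (ord0 \in B) [set k | yev k \in B].
Proof.
move=> cl; apply/setP => q.
by case: (ord_pairP q) => [|k|k]; rewrite !in_yset ?inE -?cl.
Qed.

End PairSets.

Lemma scale_pythagorean (R : realType) (m : nat) :
  exists x y : int, (Complex 3 (-4) : R[i]%C) ^+ m.+1 =
    Complex (5 * x%:~R + 3) (5 * y%:~R - 4).
Proof.
elim: m => [|m [x [y E]]].
  by exists 0, 0; apply/eqP; rewrite expr1 eq_complex /= !mulr0 !add0r !eqxx.
(* These come from (3 - 4i)^2 = (3 - 4i) - 5 (2 + 4i). *)
exists (3 * x + 4 * y - 2), (3 * y - 4 * x - 4); rewrite exprS E.
apply/eqP; rewrite eq_complex /= !rmorphB !rmorphD !rmorphM /=.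
by apply/andP; split; apply/eqP; ring.
Qed.

(* (3 - 4i)/5 is not a root of unity: modulo 5, every power of 3 - 4i is
   congruent to 3 - 4i. *)
Lemma pythagorean_pow_neq1 (R : realType) (m : nat) :
  (Complex (3 / 5) (- (4 / 5)) : R[i]%C) ^+ m.+1 != 1.
Proof.
apply/eqP => E; have [x [y Exy]] := scale_pythagorean R m.
have five : (Complex 3 (-4) : R[i]%C) = Complex 5 0 * Complex (3 / 5) (- (4 / 5)).
  by apply/eqP; rewrite eq_complex /=; apply/andP; split; apply/eqP; field.
have five_pow k : exists r, (Complex 5 0 : R[i]%C) ^+ k = Complex r 0.
  elim: k => [|k [r Er]]; first by exists 1.
  exists (5 * r); rewrite exprS Er; apply/eqP; rewrite eq_complex /=.
  by apply/andP; split; apply/eqP; ring.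
have [r Er] := five_pow m.+1.
(* If the power were 1, the power of 3 - 4i would be real, so its imaginary part would give
   [5 * y = 4] in the integers. *)
move: Exy; rewrite five exprMn E mulr1 Er => -[_ /esym/eqP].
rewrite subr_eq0 => /eqP e4.
have : (5 * y)%:~R = (4 : int)%:~R :> R by rewrite rmorphM /= e4.
by move/eqP; rewrite eqr_int => /eqP; lia.
Qed.

Section Monomial.
Variables (R : realType) (n : nat).
Local Notation C := R[i]%C.

Definition monomial (p : {perm 'I_n}) (d : 'I_n -> quat R) : 'M[quat R]_n :=
  \matrix_(j, k) if j == p k then d k else 0.

Lemma monomial_Sp p d : (forall k, qnorm (d k) = 1) -> Sp (monomial p d).
Proof.
move=> d1; split; apply/matrixP => j l; rewrite !mxE.
  rewrite (bigD1 (p^-1 j)%g) //= big1 => [|k kj]; last first.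
    rewrite adjqE !mxE; case: eqP => [jk|]; last by rewrite mul0r.
    by rewrite jk permK eqxx in kj.
  rewrite adjqE !mxE permKV eqxx addr0 eq_sym; case: eqP => _; last by rewrite conjq0 mulr0.
  by rewrite mulq_conj d1.
rewrite (bigD1 (p j)) //= big1 => [|k kj]; last first.
  by rewrite adjqE !mxE (negPf kj) conjq0 mul0r.
rewrite adjqE !mxE eqxx addr0 (inj_eq perm_inj); case: eqP => [->|_]; last by rewrite mulr0.
by rewrite mul_conjq d1.
Qed.

Lemma monomial1 : monomial 1%g (fun=> 1) = 1%:M.
Proof.
by apply/matrixP => j k; rewrite !mxE perm1; case: eqP.
Qed.

Section LiftMonomial.
Variables (z : quat R) (p : {perm 'I_n}) (d : 'I_n -> quat R) (Uz : U1 z).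
Hypothesis d_circle : forall k, U1 (d k).
Local Notation h := (hmx z (monomial p d)).

Lemma lift_yev_monomial k :
  lift_y h (yev k) = (qcirc z * qcirc (d k)) *: gen R (yev (p k)).
Proof.
rewrite lift_yev // (bigD1 (p k)) //= big1 => [|j /negPf jk].
  rewrite mxE eqxx addr0; have [dj dk _] := d_circle k.
  rewrite dj dk oppr0 scalerDr !scalerA -/(qcirc (d k)).
  by rewrite [X in _ * X *: gen R (yod _)](_ : _ = 0) // mulr0 scale0r addr0.
by rewrite mxE jk /= oppr0 !scale0r addr0.
Qed.

Lemma lift_yod_monomial k :
  lift_y h (yod k) = (qcirc z * (qcirc (d k))^*%C) *: gen R (yod (p k)).
Proof.
rewrite lift_yod // (bigD1 (p k)) //= big1 => [|j /negPf jk].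
  rewrite mxE eqxx addr0; have [dj dk _] := d_circle k.
  rewrite dj dk scalerDr !scalerA /qcirc /= opprK.
  by rewrite [X in _ * X *: gen R (yev _)](_ : _ = 0) // mulr0 scale0r add0r.
by rewrite mxE jk /= !scale0r addr0.
Qed.

End LiftMonomial.

End Monomial.

(** * The character chi and the space of invariants *)

Section Invariants.
Variables (R : realType) (n : nat) (a t : R) (a_gt0 : 0 < a) (t_gt0 : 0 < t).
Local Notation C := R[i]%C.
Local Notation I := 'I_(2 * n).+1.
Local Notation M := 'M[quat R]_(1 + n).
Variable s : M -> cliff (-1 : R) (4 * n).+2.
Hypothesis s_lift : isotropy_lift a t s.
Implicit Types (h : M) (eta : spinor R n) (z : quat R) (A : 'M[quat R]_n).

Local Notation T h := (srep (s h)).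

Definition chi z A : C := vac s (hmx z A) * qcirc z ^+ n.+1.

Lemma pol1_y1_omega : pol (1 : spinor R n) (y_ R n 1 * omega R n ^+ n) = (n`!)%:R.
Proof.
rewrite cliff_oneE pol_base big_set0 mul1r setC0 -ysetT scoef_y1 scoef_omegaX /=.
by rewrite cardsT card_ord eqxx.
Qed.

Lemma chi_sqr z A : U1 z -> Sp A -> chi z A ^+ 2 = 1.
Proof.
move=> Uz SA; have Uh := hmx_U1Sp Uz SA.
have := pol_spin 1 (y_ R n 1 * omega R n ^+ n) (lift_spin s_lift Uh).
rewrite (lift_vac a_gt0 t_gt0 s_lift) // (lift_y1_omegaX a_gt0 t_gt0 s_lift) //.
rewrite polZl polZr pol1_y1_omega => E.
have f0 : (n`!)%:R != 0 :> C by rewrite pnatr_eq0 -lt0n fact_gt0.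
apply: (mulIf f0); rewrite mul1r -[RHS]E /chi mul2n -addnn exprD.
by move: (_ ^+ n.+1) => u; ring.
Qed.

Lemma chiM z A z' A' : U1 z -> Sp A -> U1 z' -> Sp A' ->
  chi (z * z') (A *m A') = chi z A * chi z' A'.
Proof.
move=> Uz SA Uz' SA'; rewrite /chi qcircM // exprMn.
suff -> : vac s (hmx (z * z') (A *m A')) = vac s (hmx z A) * vac s (hmx z' A').
  by move: (qcirc z ^+ _) (qcirc z' ^+ _) => u v; ring.
rewrite {1}/vac -hmxM (liftM s_lift) //; try exact: hmx_U1Sp.
rewrite (lift_vac a_gt0 t_gt0 s_lift Uz' SA') srepZr.
by rewrite (lift_vac a_gt0 t_gt0 s_lift Uz SA) !scoefZ scoef1 eqxx mulr1 mulrC.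
Qed.

(* [chi] is a character with values +-1 of a group generated by squares. *)
Lemma chi1 z A : U1 z -> Sp A -> chi z A = 1.
Proof.
move=> Uz SA; have U1_ := U1_1 R; have S1 := Sp1 R n.
have := chiM Uz S1 U1_ SA; rewrite mulr1 mul1mx => ->.
have c1 B : Sp B -> chi 1 B = 1.
  move: B; apply: Sp_square_ind => [B1 B2 S_B1 S_B2 c1 c2|B SB].
    by have := chiM U1_ S_B1 U1_ S_B2; rewrite mulr1 c1 c2 mulr1.
  by have := chiM U1_ SB U1_ SB; rewrite mulr1 -expr2 chi_sqr.
rewrite c1 // mulr1.
have z1 : qnorm z = 1.
  by case: Uz => zj zk zn; rewrite /qnorm zj zk zn; ring.
have [r [r1 zr rc]] := qnorm_sqrt z1.
have Ur : U1 r.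
  case: Uz => zj zk _; have [rj rk] := rc zj zk; split=> //.
  by move: r1; rewrite /qnorm rj rk => <-; ring.
by have := chiM Ur S1 Ur S1; rewrite -zr mulmx1 -expr2 chi_sqr.
Qed.

Lemma vac1 A : Sp A -> vac s (hmx 1 A) = 1.
Proof.
move=> SA; have <- := chi1 (U1_1 R) SA; rewrite /chi.
have -> : qcirc (1 : quat R) = 1 by apply/eqP; rewrite eq_complex /= oppr0 !eqxx.
by rewrite expr1n mulr1.
Qed.

Definition invariant eta := forall z A, U1 z -> Sp A -> T (hmx z A) eta = eta.

Lemma invariantE eta : invariant_spinor s eta <-> invariant eta.
Proof.
split=> [inv z A Uz SA|inv h [z [A [Uz SA ->]]]].
  by rewrite -[RHS](inv _ (hmx_U1Sp Uz SA)) spin_repE.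
by rewrite spin_repE; apply: inv.
Qed.

Lemma invariantZD eta1 eta2 c : invariant eta1 -> invariant eta2 ->
  invariant (eta1 + c *: eta2).
Proof. by move=> i1 i2 z A Uz SA; rewrite srepDr srepZr i1 // i2. Qed.

Lemma invariant_psi_plus : odd n -> invariant (psi_plus R n).
Proof.
move=> on z A Uz SA; rewrite /psi_plus (lift_omegaX a_gt0 t_gt0 s_lift) //.
have -> : (2 * n.+1./2 = n.+1)%N by lia.
by rewrite -/(chi z A) chi1 // scale1r.
Qed.

Lemma invariant_psi_minus : odd n -> invariant (psi_minus R n).
Proof.
move=> on z A Uz SA; rewrite /psi_minus (lift_y1_omegaX a_gt0 t_gt0 s_lift) //.
have -> : (2 * n.-1./2.+1 = n.+1)%N by lia.
by rewrite -/(chi z A) chi1 // scale1r.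
Qed.

(** * Monomials that pair nontrivially with an invariant spinor *)

Section Support.
Variable eta : spinor R n.
Hypothesis eta_inv : invariant eta.
Local Notation f B := (pol (cliff_base 0 B) eta).

Lemma pol_invariant z A B : U1 z -> Sp A -> pol (T (hmx z A) (cliff_base 0 B)) eta = f B.
Proof.
move=> Uz SA; rewrite -{1}(eta_inv Uz SA).
exact: pol_spin (lift_spin s_lift (hmx_U1Sp Uz SA)).
Qed.

Lemma lift_base_diag z A (B : {set I}) (mu : I -> C) : U1 z -> Sp A ->
  (forall q, q \in B -> lift_y (hmx z A) q = mu q *: gen R q) ->
  T (hmx z A) (cliff_base 0 B) =
  (vac s (hmx z A) * \prod_(q in B) mu q) *: cliff_base 0 B.
Proof.
move=> Uz SA hmu; rewrite {1}cliff_base_gen (lift_prod a_gt0 t_gt0 s_lift) //.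
rewrite -scalerA; congr (_ *: _); rewrite cliff_base_gen -big_enum.
have : {subset enum B <= B} by move=> q; rewrite mem_enum.
elim: (enum B) => [|q r IHr] sB; first by rewrite !big_nil scale1r.
rewrite !big_cons hmu ?sB ?mem_head // IHr => [|x xr]; last by rewrite sB // inE xr orbT.
by rewrite -scalerAl -scalerAr scalerA.
Qed.

(** Invariance of the form and of [eta] shows that [f B] equals itself times the eigenvalue of the
    monomial. *)
Lemma weight_vanish z A (B : {set I}) (mu : I -> C) : U1 z -> Sp A ->
  (forall q, q \in B -> lift_y (hmx z A) q = mu q *: gen R q) ->
  vac s (hmx z A) * \prod_(q in B) mu q != 1 -> f B = 0.
Proof.
move=> Uz SA hmu; apply: contraNeq => fB.
have := pol_invariant B Uz SA; rewrite (lift_base_diag Uz SA hmu) polZl.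
by move/(canRL (mulfK fB)) => ->; rewrite divff.
Qed.

Lemma qcirc1 : qcirc (1 : quat R) = 1.
Proof. by apply/eqP; rewrite eq_complex /= oppr0 !eqxx. Qed.

Lemma support_weight (B : {set I}) : f B != 0 -> (#|B| + (ord0 \in B) = n.+1)%N.
Proof.
pose z : quat R := Quat (3 / 5) (4 / 5) 0 0; pose zeta : C := qcirc z.
have Uz : U1 z by split=> //=; field.
have S1 : Sp (1%:M : 'M[quat R]_n) := Sp1 R n.
(* The vertical generator y_1 is scaled by [zeta ^+ 2] and every other generator by [zeta]. As [chi]
   is 1, the scalar on the vacuum is the inverse of [zeta ^+ n.+1]; since [zeta] is not a root of
   unity, the exponents must agree. *)
pose mu (q : I) := zeta * (if q == ord0 then zeta else 1).
have hmu q : q \in B -> lift_y (hmx z 1%:M) q = mu q *: gen R q.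
  rewrite -monomial1 /mu => _; case: (ord_pairP q) => [|k|k].
  - by rewrite eqxx /= lift_y0 // expr2.
  - by rewrite (lift_yev_monomial _ Uz) ?yE ?perm1 ?qcirc1 // => l; apply: U1_1.
  rewrite (lift_yod_monomial _ Uz) ?yE ?perm1 ?qcirc1 ?conjc1 // => l; exact: U1_1.
move=> fB; have [E|] := eqVneq (vac s (hmx z 1%:M) * \prod_(q in B) mu q) 1; last first.
  by move/(weight_vanish Uz S1 hmu) => f0; rewrite f0 eqxx in fB.
have prodE : \prod_(q in B) mu q = zeta ^+ (#|B| + (ord0 \in B)).
  rewrite big_split prodr_const exprD -big_mkcondr /=; congr (_ * _).
  case: (boolP (ord0 \in B)) => B0.
    by rewrite (big_pred1 ord0) // => q /=; case: eqP => [->|]; rewrite ?B0 ?andbF.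
  by rewrite big_pred0 // => q; case: eqP => [->|]; rewrite ?(negPf B0) ?andbF.
have c := chi1 Uz S1; rewrite /chi -/zeta in c.
have v0 : vac s (hmx z 1%:M) != 0.
  by apply: contraTneq (oner_neq0 C) => v0; rewrite -c v0 mul0r eqxx.
have : zeta ^+ (#|B| + (ord0 \in B)) = zeta ^+ n.+1.
  by apply: (mulfI v0); rewrite c -prodE E.
have pow_inj k l : (k <= l)%N -> zeta ^+ k = zeta ^+ l -> k = l.
  move=> kl; rewrite -(subnK kl) exprD; case: (l - k)%N => [//|m] e.
  have z0 : zeta ^+ k != 0.
    by rewrite expf_neq0 // eq_complex /= negb_and; apply/orP; left; apply/eqP; lra.
  have e1 : 1 = zeta ^+ m.+1 by apply: (mulIf z0); rewrite mul1r -e.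
  by case/eqP: (pythagorean_pow_neq1 R m); rewrite [RHS]e1.
by case: (leqP (#|B| + (ord0 \in B)) n.+1) => [/pow_inj//|/ltnW/pow_inj e /esym/e].
Qed.

(** The diagonal matrix with i in place [k] scales [yev k] by -i and [yod k] by i and fixes the
    vacuum and the other generators. The eigenvalue is 1 only if both or neither of the two
    occur. *)
Lemma support_closed (B : {set I}) k : f B != 0 -> (yev k \in B) = (yod k \in B).
Proof.
pose d l : quat R := if l == k then iq else 1.
have d1 l : U1 (d l) by rewrite /d; case: eqP => _; split=> //=; ring.
have n1 l : qnorm (d l) = 1 by have [dj dk dn] := d1 l; rewrite /qnorm dj dk dn; ring.
have SA := monomial_Sp 1%g n1; have U1_ := U1_1 R.
pose ic : C := Complex 0 (-1).
have qd l : qcirc (d l) = if l == k then ic else 1.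
  by rewrite /d; case: eqP => _ //; rewrite qcirc1.
pose mu (q : I) : C := if q == yev k then ic else if q == yod k then ic^*%C else 1.
have hmu q : q \in B -> lift_y (hmx 1 (monomial 1%g d)) q = mu q *: gen R q.
  rewrite /mu => _; case: (ord_pairP q) => [|l|l].
  - by rewrite ![ord0 == _]eq_sym !yE lift_y0 // qcirc1 expr1n.
  - by rewrite lift_yev_monomial // !yE perm1 qcirc1 mul1r qd.
  rewrite lift_yod_monomial // !yE perm1 qcirc1 mul1r qd.
  by case: eqP => _ //; rewrite conjc1.
move=> fB; have := weight_vanish U1_ SA hmu; rewrite vac1 // mul1r => w.
have {}w : \prod_(q in B) mu q = 1 by apply: contra_neq_eq fB.
have ic1 : ic != 1 by rewrite eq_complex /= eq_sym oner_eq0.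
have ic2 : ic^*%C != 1 by rewrite eq_complex /= eq_sym oner_eq0.
case: (boolP (yev k \in B)) => kev; case: (boolP (yod k \in B)) => kod //.
  move: w; rewrite (bigD1 (yev k)) //= big1 => [|q /andP[qB /negPf qk]].
    by rewrite /mu eqxx mulr1 => /eqP; rewrite (negPf ic1).
  by rewrite /mu qk; case: eqP => // qod; rewrite -qod qB in kod.
move: w; rewrite (bigD1 (yod k)) //= big1 => [|q /andP[qB /negPf qk]].
  by rewrite /mu eqxx !yE mulr1 => /eqP; rewrite (negPf ic2).
by rewrite /mu qk; case: eqP => // qev; rewrite -qev qB in kev.
Qed.

(** The transposition of [p] and [p'] carries the pair of [p] to that of [p'] and fixes the pairs in
    [S :\ p], which contains neither. No sign arises from moving a pair. *)
Lemma support_exchange b (S : {set 'I_n}) p p' : p \in S -> p' \notin S ->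
  f (yset b S) = f (yset b (p' |: S :\ p)).
Proof.
move=> pS p'S; have U1_ := U1_1 R; pose one (_ : 'I_n) : quat R := 1.
have SA : Sp (monomial (tperm p p') one).
  by apply: monomial_Sp => k; rewrite /one /qnorm /=; ring.
have Uone k : U1 (one k) by [].
have Uh := hmx_U1Sp U1_ SA.
have hev k : lift_y (hmx 1 (monomial (tperm p p') one)) (yev k) = gen R (yev (tperm p p' k)).
  by rewrite lift_yev_monomial // !qcirc1 mulr1 scale1r.
have hod k : lift_y (hmx 1 (monomial (tperm p p') one)) (yod k) = gen R (yod (tperm p p' k)).
  by rewrite lift_yod_monomial // !qcirc1 conjc1 mulr1 scale1r.
have fixB : srep (s (hmx 1 (monomial (tperm p p') one))) (cliff_base 0 (yset b (S :\ p))) =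
    cliff_base 0 (yset b (S :\ p)).
  rewrite (@lift_base_diag _ _ _ (fun=> 1)) // => [|q].
    by rewrite vac1 // big1 // mulr1 scale1r.
  case: (ord_pairP q) => [|k|k]; rewrite !in_yset scale1r.
  - by rewrite lift_y0 // qcirc1 expr1n scale1r.
  - rewrite !inE => /andP[kp kS]; rewrite hev tpermD // eq_sym //.
    by apply: contraNneq p'S => <-.
  rewrite !inE => /andP[kp kS]; rewrite hod tpermD // eq_sym //.
  by apply: contraNneq p'S => <-.
rewrite -(pol_invariant _ U1_ SA); congr (pol _ eta).
rewrite -{1}(setD1K pS) -base_pair ?setD11 //.
rewrite !(lift_gen a_gt0 t_gt0 s_lift) // hev hod tpermL fixB base_pair //.
by rewrite !inE negb_and p'S orbT.
Qed.

Lemma support_yset (B : {set I}) : f B != 0 -> exists (b : bool) (S : {set 'I_n}),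
  B = yset b S /\ (2 * (b + #|S|) = n.+1)%N.
Proof.
move=> fB; have BE := yset_closed (fun k => support_closed k fB).
exists (ord0 \in B), [set k | yev k \in B]; split=> //.
have cB : #|B| = ((ord0 \in B) + 2 * #|[set k | yev k \in B]|)%N by rewrite {1}BE card_yset.
by rewrite -(support_weight fB) cB mulnDr mul2n -addnn addnAC.
Qed.

Lemma invariant_even : ~~ odd n -> eta = 0.
Proof.
move=> n_even; apply: pol_nondeg => B; apply/eqP; apply: contraNT n_even => fB.
by have [b [S [_ e]]] := support_yset fB; lia.
Qed.

(** By exchange, one coefficient for each degree in y_1 determines all others. The form reads the
    coefficient of the complementary monomial, which is why [S] is exchanged with the complement of
    [S0] or [S1]. *)
Lemma invariant_eq0 (S0 S1 : {set 'I_n}) : #|S0| = n.+1./2 -> #|S1| = n.-1./2 ->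
  scoef eta (yset false S0) = 0 -> scoef eta (yset true S1) = 0 -> eta = 0.
Proof.
move=> card0 card1 eta0 eta1; apply: pol_nondeg => B; apply/eqP/negPn/negP => fB.
have [b [S [BE e]]] := support_yset fB; move/negP: fB; apply; rewrite BE.
have exch := card_exchange_invariant (@support_exchange b).
have := cardsC S0; have := cardsC S1; rewrite card_ord => c1 c0.
case: b e {BE} exch => e exch.
  rewrite (exch S (~: S0)); last by lia.
  by rewrite pol_base setC_yset setCK /= eta0 mulr0.
rewrite (exch S (~: S1)); last by lia.
by rewrite pol_base setC_yset setCK /= eta1 mulr0.
Qed.

End Support.

Lemma invariant_span eta : odd n -> invariant eta ->
  exists c d, eta = c *: psi_plus R n + d *: psi_minus R n.
Proof.
move=> n_odd inv.
have cards m : (m <= n)%N -> exists S : {set 'I_n}, #|S| = m.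
  move=> le_mn; exists [set k : 'I_n | (k < m)%N].
  rewrite -sum1_card (eq_bigl (fun k : 'I_n => (k < m)%N)) => [|k]; last by rewrite inE.
  by rewrite -(big_ord_widen _ (fun=> 1%N)) // sum1_card card_ord.
have [|S0 card0] := cards n.+1./2; first by lia.
have [|S1 card1] := cards n.-1./2; first by lia.
(* The factorials are the coefficients of the powers of omega at these sets, so subtracting the
   combination kills one coefficient of each y_1-degree. *)
pose c := scoef eta (yset false S0) / (n.+1./2`!)%:R.
pose d := scoef eta (yset true S1) / (n.-1./2`!)%:R.
exists c, d; apply/eqP; rewrite -subr_eq0; apply/eqP.
have f0 m : (m`!)%:R != 0 :> C by rewrite pnatr_eq0 -lt0n fact_gt0.
have -> : eta - (c *: psi_plus R n + d *: psi_minus R n) =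
    eta + (- c) *: psi_plus R n + (- d) *: psi_minus R n.
  by rewrite opprD addrA !scaleNr.
apply: (invariant_eq0 _ card0 card1).
- apply: invariantZD; last exact: invariant_psi_minus.
  by apply: invariantZD => //; apply: invariant_psi_plus.
- rewrite !scoefD !scoefZ scoef_y1 scoef_omegaX card0 eqxx /= mulr0 addr0.
  by rewrite mulNr /c divfK // subrr.
rewrite !scoefD !scoefZ scoef_y1 !scoef_omegaX card1 eqxx /= mulr0 addr0.
by rewrite mulNr /d divfK // subrr.
Qed.

End Invariants.

Theorem theorem3p8 (R : realType) (n : nat) (a t : R)
    (n_ge1 : (1 <= n)%N) (a_gt0 : 0 < a) (t_gt0 : 0 < t)
    (sigma_tilde : 'M[quat R]_(1 + n) -> cliff (-1 : R) (4 * n).+2)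
    (sigma_tilde_lift : isotropy_lift a t sigma_tilde)
    (eta : spinor R n) :
  invariant_spinor sigma_tilde eta <->
  eta \in (if odd n then <<[:: psi_plus R n; psi_minus R n]>>%VS else 0%VS).
Proof.
rewrite invariantE; case: (boolP (odd n)) => n_odd; last first.
  rewrite memv0; split=> [inv|/eqP -> z A _ _].
    by apply/eqP; apply: (invariant_even a_gt0 t_gt0 sigma_tilde_lift inv).
  by rewrite -(scale0r 0) srepZr !scale0r.
rewrite span_cons span_seq1; split=> [inv|].
  have [c [d ->]] := invariant_span a_gt0 t_gt0 sigma_tilde_lift n_odd inv.
  by rewrite memv_add // memvZ // memv_line.
case/memv_addP => _ /vlineP[c ->] [_ /vlineP[d ->] ->].
apply: invariantZD.
  rewrite -[c *: _]add0r; apply: invariantZD.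
    by move=> z A _ _; rewrite -(scale0r 0) srepZr !scale0r.
  exact: (invariant_psi_plus a_gt0 t_gt0 sigma_tilde_lift n_odd).
exact: (invariant_psi_minus a_gt0 t_gt0 sigma_tilde_lift n_odd).
Qed.
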